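(* Let $f:M\to M$ be a $C^1$ diffeomorphism. Then $x\in M$ belongs to a repelling periodic orbit (a source) of $f$ if, and only if, $\tilde A^-_k(x)<0$ for some $k\in\mathbb{Z}^+$.
   Context: $M$ is a connected compact $d$-dimensional manifold, $d\ge 2$, endowed with a Riemannian metric inducing a norm $\|\cdot\|$ on the tangent bundle (and operator norms) and a distance $\operatorname{dist}$ on $M$. For $k\in\mathbb{Z}^+$ set $$\tilde A^-_k(x)=\liminf_{n\to\infty}\frac1n\sum_{j=0}^{n-1}\ln\big\|\big(Df^k(f^{kj}x)\big)^{-1}\big\|.$$ For a map $g:M\to M$, a point $p$ with $g^\tau p=p$ for some $\tau\in\mathbb{Z}^+$ (not required to be minimal) belongs to the periodic orbit $\{p,gp,\dots,g^{\tau-1}p\}$; this orbit is attracting for $g$ if there is a neighborhood $V_p$ of $p$ such that $g^\tau|_{V_p}:V_p\to V_p$ is a contraction (there is $0<\lambda<1$ with $\operatorname{dist}(g^\tau q,g^\tau r)<\lambda\operatorname{dist}(q,r)$ for all distinct $q,r\in V_p$; equivalently $\|Dg^\tau(p)\|<\lambda$ for some $\lambda\in(0,1)$). A periodic orbit of the diffeomorphism $f$ is repelling (a source) if it is an attracting periodic orbit for $f^{-1}$. *)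

(* Defs.v *)
From HB Require Import structures.
From mathcomp Require Import all_boot all_order all_algebra.
From mathcomp Require Import all_classical all_reals all_analysis.

Set Implicit Arguments.
Unset Strict Implicit.
Unset Printing Implicit Defensive.
Import Order.TTheory GRing.Theory Num.Theory.
Import numFieldNormedType.Exports.
Local Open Scope classical_set_scope.
Local Open Scope ring_scope.

(* [Ck n U g]: the total function [g] is of class C^n on the open set [U].
   All derivatives are directional derivatives, so for finite-dimensional [V]
   this is the usual notion; values of [g] outside [U] play no role. *)
Fixpoint Ck (R : realType) (V W : normedModType R) (n : nat) (U : set V)
    (g : V -> W) : Prop :=
  match n with
  | 0%N => forall x, U x -> {for x, continuous g}
  | k.+1 => (forall x, U x -> differentiable g x) /\
            (forall v, Ck k U ('D_v g))
  end.

Definition smooth_on (R : realType) (V W : normedModType R) (U : set V)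
    (g : V -> W) : Prop := forall n, Ck n U g.

(* A chart is a homeomorphism from an open set [dom] of [M] onto an open subset
   of R^d. Both [chart_map] and its inverse are totalised; their values
   outside [dom], respectively outside the image of [dom], are junk. *)
Record chart (R : realType) (d : nat) (M : topologicalType) := Chart {
  dom : set M ;
  chart_map :> M -> 'rV[R]_d ;
  chart_inv : 'rV[R]_d -> M ;
  open_dom : open dom ;
  open_codom : open (chart_map @` dom) ;
  chart_mapK : forall x, dom x -> chart_inv (chart_map x) = x ;
  chart_map_continuous : forall x, dom x -> {for x, continuous chart_map} ;
  chart_inv_continuous :
    forall y, (chart_map @` dom) y -> {for y, continuous chart_inv} }.

(* C^oo manifold of dimension [d]. Second countability is not required: it
   is automatic for the compact manifolds considered here. The chart
   [chart_at x] identifies the tangent space at [x] with R^d, so that a tangent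
   vector at [x] is a row vector. *)
Record manifold (R : realType) (d : nat) := Manifold {
  carrier :> topologicalType ;
  carrier_hausdorff : hausdorff_space carrier ;
  atlas : set (chart R d carrier) ;
  chart_at : carrier -> chart R d carrier ;
  chart_at_atlas : forall x, atlas (chart_at x) ;
  chart_at_dom : forall x, dom (chart_at x) x ;
  atlas_compat : forall a b, atlas a -> atlas b ->
    smooth_on (a @` (dom a `&` dom b)) (b \o chart_inv a) }.

(* [to_tangent c x] is the matrix, acting on the right on row vectors, that maps
   the components of a tangent vector at [x] in the chart [c] to its components
   in [chart_at x]. *)
Definition to_tangent (R : realType) (d : nat) (M : manifold R d)
    (c : chart R d M) (x : M) : 'M[R]_d :=
  jacobian (chart_at x \o chart_inv c) (c x).

(* [gram x] is the Gram matrix of the inner product on the tangent space at [x].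
   Since [chart_at x] jumps with [x], smoothness of the metric is expressed
   through its components in each chart of the atlas. *)
Record riemannian_metric (R : realType) (d : nat) (M : manifold R d) :=
  RiemannianMetric {
  gram : M -> 'M[R]_d ;
  gram_sym : forall x, (gram x)^T = gram x ;
  gram_posdef : forall x (v : 'rV[R]_d), v != 0 -> 0 < (v *m gram x *m v^T) 0 0 ;
  gram_smooth : forall c, atlas c ->
    smooth_on (c @` dom c)
      (fun y => let J := to_tangent c (chart_inv c y) in
                J *m gram (chart_inv c y) *m J^T) }.

Section Riemannian.
Context {R : realType} {d : nat} {M : manifold R d}.
Variable G : riemannian_metric M.

Definition tnorm (x : M) (v : 'rV[R]_d) : R :=
  Num.sqrt ((v *m gram G x *m v^T) 0 0).

(* Operator norm of the linear map [v |-> v *m A] from T_x M to T_y M. *)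
Definition opnorm (x y : M) (A : 'M[R]_d) : R :=
  sup [set tnorm y (v *m A) | v in [set v | tnorm x v <= 1]].

(* [C1_curve c]: the restriction of [c] to [0, 1] is a C^1 curve, C^1 at the
   end points meaning that it extends as such to a neighbourhood of [0, 1]. *)
Definition C1_curve (c : R -> M) : Prop :=
  exists U : set R, [/\ open U, `[0, 1] `<=` U,
    forall t, U t -> {for t, continuous c} &
    forall a, atlas a -> Ck 1 (U `&` c @^-1` dom a) (a \o c)].

Definition velocity (c : R -> M) (t : R) : 'rV[R]_d :=
  'D_1 (chart_at (c t) \o c) t.

Definition curve_length (c : R -> M) : R :=
  \int[lebesgue_measure]_(t in `[0, 1]) tnorm (c t) (velocity c t).

(* [joined p q l]: a piecewise C^1 curve of length [l] goes from [p] to [q],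
   each of its C^1 pieces being parametrised by [0, 1]. *)
Inductive joined : M -> M -> R -> Prop :=
| joined_refl p : joined p p 0
| joined_cons c q l : C1_curve c -> joined (c 1) q l ->
    joined (c 0) q (curve_length c + l).

Definition dist (p q : M) : R := inf [set l | joined p q l].

(* [tau] need not be the minimal period of [p]. *)
Definition periodic (g : M -> M) (p : M) (tau : nat) : Prop :=
  (0 < tau)%N /\ iter tau g p = p.

Definition orbit_set (g : M -> M) (p : M) (tau : nat) : set M :=
  [set iter i g p | i in [set i | (i < tau)%N]].

Definition attracting (g : M -> M) (p : M) (tau : nat) : Prop :=
  periodic g p tau /\
  exists V : set M,
    [/\ nbhs p V, forall q, V q -> V (iter tau g q) &
      exists lambda : R, 0 < lambda < 1 /\
        forall q r, V q -> V r -> q <> r ->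
          dist (iter tau g q) (iter tau g r) < lambda * dist q r].

(* [finv] stands for the inverse of [f]; the orbits of [p] under [f] and under
   [finv] are then the same set. *)
Definition in_repelling_orbit (f finv : M -> M) (x : M) : Prop :=
  exists (p : M) (tau : nat),
    [/\ periodic f p tau, orbit_set f p tau x & attracting finv p tau].

End Riemannian.

Section Differentiable.
Context {R : realType} {d : nat} {M : manifold R d}.

Definition C1_map (f : M -> M) : Prop :=
  continuous f /\
  forall a b, atlas a -> atlas b ->
    Ck 1 (a @` (dom a `&` f @^-1` dom b)) (b \o f \o chart_inv a).

Record C1_diffeo (f finv : M -> M) : Prop := C1Diffeo {
  diffeoK : cancel f finv ;
  diffeoKV : cancel finv f ;
  diffeo_C1 : C1_map f ;
  diffeo_inv_C1 : C1_map finv }.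

(* Matrix of Df(x) : T_x M -> T_(f x) M, acting on the right on row vectors. *)
Definition mdiff (f : M -> M) (x : M) : 'M[R]_d :=
  jacobian (chart_at (f x) \o f \o chart_inv (chart_at x)) (chart_at x x).

End Differentiable.

Section Exponent.
Context {R : realType} {d : nat} {M : manifold R d}.
Variable G : riemannian_metric M.

(* || Df(x)^-1 || *)
Definition norm_inv_diff (f : M -> M) (x : M) : R :=
  opnorm G (f x) x (invmx (mdiff f x)).

Definition A_minus (f : M -> M) (k : nat) (x : M) : \bar R :=
  limn_einf (fun n : nat =>
    (n%:R^-1 * \sum_(j < n)
       ln (norm_inv_diff (iter k f) (iter (k * j) f x)))%:E).

End Exponent.

(* Main.v *)
Require Import Defs.
From mathcomp Require Import all_boot all_order all_algebra.
From mathcomp Require Import all_classical all_reals all_analysis.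
From mathcomp Require Import ring lra.
Set Implicit Arguments.
Unset Strict Implicit.
Unset Printing Implicit Defensive.
Import Order.TTheory GRing.Theory Num.Theory.
Import numFieldNormedType.Exports.
Local Open Scope classical_set_scope.
Local Open Scope ring_scope.

(** The point [x] is a source when backward iteration contracts a neighbourhood
    of its orbit. Put [g = f^k] and let [phi q] be the norm of the derivative of
    the inverse of [g] at [q], so that the exponent is the lower limit of the
    averages of [ln (phi (g^(j+1) x))] ([norm_inv_diffE], [A_minusE]).

    Suppose that the exponent is negative. For some [c > 0] the sums of
    [ln (phi (g^(j+1) x)) + c] over [j < n] are unbounded below, hence have
    infinitely many record minima [n] ([record_minima]). At such a hyperbolic
    time the products of [phi] along the backward orbit of [g^n x] are at most
    [exp (- c i)] for every [i <= n] ([hyperbolic_prod]). The function [phi] is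
    continuous and the manifold compact, so on a ball around [g^n x] of radius
    independent of [n] the inverse of [g^i], for [i <= n], contracts distances
    by [exp (- c i / 2)] ([uniform_stretch_radius], [contraction_along_orbit]).
    By compactness two hyperbolic times [n < m] have [g^n x] and [g^m x] close
    to a common cluster point; the inverse [F] of [g^(m-n)] then maps a
    neighbourhood [W] of that point into itself and contracts it
    ([contracted_ball]). The orbit visits [W] infinitely often. Dividing the
    times of visit by [N = m - n] shows that among the points [g^r x] with
    [r < N] there are some that [F] moves by an arbitrarily small amount; since
    they are finitely many, one of them is fixed by [F]. Hence [x] lies on a
    periodic orbit, which is attracting for the inverse of [f]
    ([negative_exponent_source]).

    Conversely, let the inverse of [f^tau] contract a neighbourhood of its fixed
    point [p] by [lam]. Its [n]-th iterate contracts by [lam^n], and the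
    distance is comparable with the norm of a chart near [p], so the derivative
    of that iterate at [p] has norm at most a constant times [lam^n]
    ([attracting_diff_norm]). Moving along the orbit from [p] to [x] only
    changes the constant. For [n] large the norm is less than 1, and as [x] is
    fixed by [f^(n tau)], the exponent for [k = n tau] is the logarithm of this
    norm ([source_negative_exponent]).

    What remains is the local geometry behind the word contracts. Tangent
    vectors at different points live in different charts, so derivatives are
    read in arbitrary pairs of charts ([jac]), for which the chain rule holds;
    [to_tangent] and [mdiff] are special cases. Continuity of the norms follows
    from a pinching estimate for positive definite forms ([qform_near]). A map
    multiplies lengths of curves by at most a bound of its derivative
    ([curve_length_comp]). A short curve cannot leave a chart ball
    ([C1_curve_chart]), and straight segments in a chart have length comparable
    with the norm ([joined_chart_segment]); together they compare the distance
    with the norm of a chart ([comparison_ball_exists]). *)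

(** * Matrices and quadratic forms *)

Section Matrices.
Context {R : realType}.

Lemma cvg_mxP (T : Type) (F : set_system T) {FF : Filter F} m n
    (f : T -> 'M[R]_(m, n)) (A : 'M[R]_(m, n)) :
  (forall i j, f x i j @[x --> F] --> A i j) -> f @ F --> A.
Proof.
move=> fA B [P PA PB]; rewrite /nbhs /=.
have : F [set x | forall i j, P i j (f x i j)].
  apply: (@filter_forall T _ (fun i x => forall j, P i j (f x i j))) => i.
  by apply: filter_forall => j; exact/fA/PA.
by apply: filterS => x Px; exact: PB.
Qed.

Lemma cvg_coord (T : Type) (F : set_system T) {FF : Filter F} m n
    (f : T -> 'M[R]_(m, n)) (A : 'M[R]_(m, n)) i j :
  f @ F --> A -> f x i j @[x --> F] --> A i j.
Proof.
move=> fA.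
have hc := @coord_continuous R m n i j A.
exact: (@cvg_comp _ _ _ f (fun M : 'M[R]_(m, n) => M i j) _ _ _ fA hc).
Qed.

Lemma cvg_mulmx (T : Type) (F : set_system T) {FF : Filter F} m n p
    (f : T -> 'M[R]_(m, n)) (g : T -> 'M[R]_(n, p))
    (A : 'M[R]_(m, n)) (B : 'M[R]_(n, p)) :
  f @ F --> A -> g @ F --> B -> f x *m g x @[x --> F] --> A *m B.
Proof.
move=> fA gB; apply: cvg_mxP => i j; rewrite mxE.
under eq_fun do rewrite mxE.
apply: (@cvg_big _ _ +%R) => [|k _]; first by exact: add_continuous.
by apply: cvgM; exact: cvg_coord.
Qed.

Lemma cvg_trmx (T : Type) (F : set_system T) {FF : Filter F} m n
    (f : T -> 'M[R]_(m, n)) (A : 'M[R]_(m, n)) :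
  f @ F --> A -> (f x)^T @[x --> F] --> A^T.
Proof.
move=> fA; apply: cvg_mxP => i j; rewrite mxE.
by under eq_fun do rewrite mxE; exact: cvg_coord.
Qed.

Lemma coord_le_norm m n (A : 'M[R]_(m, n)) i j : `|A i j| <= `|A|.
Proof.
rewrite [leRHS]/Num.norm/= mx_normrE.
by apply/bigmax_geP; right; exists (i, j).
Qed.

Lemma norm_le_coord m n (A : 'M[R]_(m, n)) (K : R) :
  0 <= K -> (forall i j, `|A i j| <= K) -> `|A| <= K.
Proof.
move=> K0 AK; rewrite [leLHS]/Num.norm/= mx_normrE.
by apply/bigmax_leP; split => // -[i j] _; exact: AK.
Qed.

Definition qform d (Q : 'M[R]_d) (w : 'rV[R]_d) : R := (w *m Q *m w^T) 0 0.

Lemma cvg_qform (T : Type) (F : set_system T) {FF : Filter F} d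
    (f : T -> 'M[R]_d) (g : T -> 'rV[R]_d) (A : 'M[R]_d) (w : 'rV[R]_d) :
  f @ F --> A -> g @ F --> w -> qform (f x) (g x) @[x --> F] --> qform A w.
Proof.
move=> fA gw; apply: cvg_coord; apply: cvg_mulmx; last exact: cvg_trmx.
exact: cvg_mulmx.
Qed.

Lemma qformZ d (Q : 'M[R]_d) a w : qform Q (a *: w) = a ^+ 2 * qform Q w.
Proof.
by rewrite /qform linearZ/= -!scalemxAl -scalemxAr !mxE expr2 mulrA.
Qed.

Lemma qform_congr d (Q J : 'M[R]_d) w :
  qform (J *m Q *m J^T) w = qform Q (w *m J).
Proof. by rewrite /qform trmx_mul !mulmxA. Qed.

Lemma qformB d (Q Q' : 'M[R]_d) w :
  qform (Q - Q') w = qform Q w - qform Q' w.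
Proof. by rewrite /qform mulmxBr mulmxBl !mxE. Qed.

Lemma qform_le_norm d (Q : 'M[R]_d) w :
  `|qform Q w| <= (d%:R ^+ 2 * `|Q|) * `|w| ^+ 2.
Proof.
rewrite /qform mxE (le_trans (ler_norm_sum _ _ _))//.
apply: (@le_trans _ _ (\sum_(j < d) d%:R * (`|Q| * `|w| ^+ 2))); last first.
  rewrite sumr_const card_ord -[leLHS]mulr_natl le_eqVlt.
  by apply/orP; left; apply/eqP; ring.
apply: ler_sum => j _; rewrite mxE mulr_suml (le_trans (ler_norm_sum _ _ _))//.
apply: (@le_trans _ _ (\sum_(k < d) (`|Q| * `|w| ^+ 2))); last first.
  by rewrite sumr_const card_ord -[leLHS]mulr_natl.
apply: ler_sum => k _; rewrite mxE !normrM -mulrA mulrCA expr2.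
have h0 (x : R) : 0 <= `|x| by exact: normr_ge0.
by rewrite !ler_pM ?mulr_ge0 ?coord_le_norm.
Qed.

Definition posdef d (Q : 'M[R]_d) := forall w, w != 0 -> 0 < qform Q w.

Lemma posdef_ge_norm d (Q : 'M[R]_d) : posdef Q ->
  exists2 c, 0 < c & forall w, c * `|w| ^+ 2 <= qform Q w.
Proof.
move=> Qpos; pose S := [set w : 'rV[R]_d | `|w| = 1].
have q0 w : 0 <= qform Q w.
  have [->|/Qpos/ltW//] := eqVneq w 0.
  by rewrite /qform !mul0mx mxE.
have [S0|S0] := pselect (S !=set0); last first.
  exists 1 => // w; have [->|w0] := eqVneq w 0; first by rewrite normr0 expr0n/= mulr0.
  exfalso; apply: S0; exists (`|w|^-1 *: w).
  by rewrite /S/= normrZ normfV normr_id mulVf ?normr_eq0.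
have cS : compact S.
  apply: bounded_closed_compact.
    exists 1; split; first exact: num_real.
    by move=> x x1 w; rewrite /S/= => ->; exact: ltW.
  have -> : S = Num.norm @^-1` [set 1] by [].
  by apply: closed_comp => [w _|]; [exact: norm_continuous|exact: closed_eq].
have cq : continuous (qform Q).
  move=> w.
  exact: (@cvg_qform _ (nbhs w) _ _ (fun=> Q) id _ _ (cvg_cst _) cvg_id).
have [v vS vmin] := EVT_min_rV S0 cS (continuous_subspaceT cq).
rewrite inE in vS.
exists (qform Q v).
  by apply: Qpos; rewrite -normr_eq0 vS oner_eq0.
move=> w; have [->|w0] := eqVneq w 0; first by rewrite normr0 expr0n/= mulr0.
have -> : w = `|w| *: (`|w|^-1 *: w).
  by rewrite scalerA mulfV ?normr_eq0// scale1r.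
rewrite qformZ [in leLHS]scalerA mulfV ?normr_eq0// scale1r mulrC.
rewrite ler_pM2l ?exprn_gt0 ?normr_gt0//; apply: vmin.
by rewrite inE /S/= normrZ normfV normr_id mulVf ?normr_eq0.
Qed.

(** The perturbation of the form is small compared with the squared norm, which
    the positive definite value at [y] dominates; this is why one neighbourhood
    serves for all vectors. *)
Lemma qform_near (T : topologicalType) d (Q : T -> 'M[R]_d) (y : T) (e : R) :
  {for y, continuous Q} -> posdef (Q y) -> 0 < e ->
  \forall q \near y, forall w, qform (Q y) w <= (1 + e) * qform (Q q) w /\
    qform (Q q) w <= (1 + e) * qform (Q y) w.
Proof.
move=> cQ /posdef_ge_norm[c c0 cP] e0.
pose D := (d%:R ^+ 2 + 1 : R).
have D0 : 0 < D by rewrite ltr_wpDl// sqr_ge0.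
have e1 : 0 < 1 + e by rewrite addr_gt0.
pose eta := c * (e / (1 + e)) / D.
have eta0 : 0 < eta by rewrite !(mulr_gt0,divr_gt0,invr_gt0).
move/cvgrPdist_lt : cQ => /(_ eta eta0); apply: filterS => q Qq w.
have hq : `|qform (Q y) w - qform (Q q) w| <= (e / (1 + e)) * qform (Q y) w.
  rewrite -qformB (le_trans (qform_le_norm _ _))//.
  apply: (@le_trans _ _ ((D * eta) * `|w| ^+ 2)).
    rewrite ler_wpM2r ?sqr_ge0// ler_pM ?sqr_ge0//; last exact: ltW.
    by rewrite lerDl.
  have -> : D * eta = (e / (1 + e)) * c by rewrite /eta; field; rewrite !gt_eqF.
  have ee : 0 <= e / (1 + e) by rewrite divr_ge0// ltW.
  rewrite -mulrA.
  by rewrite ler_wpM2l.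
have qy0 : 0 <= qform (Q y) w by rewrite (le_trans _ (cP w))// mulr_ge0 ?sqr_ge0// ltW.
have : e / (1 + e) * qform (Q y) w <= e * qform (Q y) w.
  by rewrite ler_wpM2r// ler_pdivrMr// ler_peMr ?ltW// ltrDl.
move: hq; rewrite ler_norml => /andP[h1 h2] h3; split; last first.
  by rewrite mulrDl mul1r; lra.
rewrite -ler_pdivrMl//.
have -> : (1 + e)^-1 * qform (Q y) w = qform (Q y) w - e / (1 + e) * qform (Q y) w.
  by field; rewrite gt_eqF.
by lra.
Qed.

End Matrices.

(** * Derivatives read in charts *)

Section NearEq.
Context {R : realType}.

Lemma near_eq_differentiable (V W : normedModType R) (f g : V -> W) (x : V) :
  {near x, f =1 g} -> differentiable f x -> differentiable g x.
Proof.
move=> fg df; have fgx : f x = g x by exact: nbhs_singleton fg.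
have gE : g \o shift x = cst (g x) + 'd f x +o_ 0 id.
  apply/eqaddoP => e e0.
  have := diff_locally df => /eqaddoP/(_ e e0) fE.
  have fg0 : \forall h \near (0 : V), f (h + x) = g (h + x).
    have hx : h + x @[h --> (0 : V)] --> 0 + x.
      by apply: cvgD; [exact: cvg_id|exact: cvg_cst].
    by rewrite add0r in hx; exact: hx fg.
  near=> h; rewrite /= !fctE /=.
  have <- : f (h + x) = g (h + x) by near: h.
  by rewrite -fgx; near: h.
apply/diff_locallyP; have dfc := diff_continuous df.
have -> := diff_unique dfc gE.
by split.
Unshelve. all: by end_near. Qed.

Lemma derive_comp_near (V : normedModType R) d e (f : V -> 'rV[R]_d)
    (g : 'rV[R]_d -> 'rV[R]_e) (k : V -> 'rV[R]_e) (x : V) :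
  differentiable f x -> differentiable g (f x) -> {near x, g \o f =1 k} ->
  differentiable k x /\
    forall v, 'D_v k x = 'D_v f x *m jacobian g (f x).
Proof.
move=> df dg gfk; split.
  by apply: near_eq_differentiable gfk _; exact: differentiable_comp.
move=> v; rewrite -(near_eq_derive v gfk) deriveE; last exact: differentiable_comp.
by rewrite diff_comp// deriveE// /jacobian mul_rV_lin1.
Qed.

Lemma jacobian_comp_near d e m (f : 'rV[R]_d -> 'rV[R]_e)
    (g : 'rV[R]_e -> 'rV[R]_m) (k : 'rV[R]_d -> 'rV[R]_m) (x : 'rV[R]_d) :
  differentiable f x -> differentiable g (f x) -> {near x, g \o f =1 k} ->
  jacobian k x = jacobian f x *m jacobian g (f x).
Proof.
move=> df dg gfk; have [dk kE] := derive_comp_near df dg gfk.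
apply/row_matrixP => i; rewrite !rowE mulmxA.
by rewrite -(deriveEjacobian _ dk) -(deriveEjacobian _ df).
Qed.

Lemma jacobian_near_id d (k : 'rV[R]_d -> 'rV[R]_d) (x : 'rV[R]_d) :
  {near x, id =1 k} -> jacobian k x = 1%:M.
Proof.
move=> idk; have dk : differentiable k x.
  by apply: near_eq_differentiable idk _.
apply/row_matrixP => i; rewrite !rowE -(deriveEjacobian _ dk).
by rewrite -(near_eq_derive _ idk) derive_id mulmx1.
Qed.

End NearEq.

Lemma near_eq_continuous_at (T U : topologicalType) (f g : T -> U) (x : T) :
  {near x, f =1 g} -> {for x, continuous f} -> {for x, continuous g}.
Proof.
move=> fg cf; have fgx : f x = g x by exact: nbhs_singleton fg.
suff : g y @[y --> x] --> f x by rewrite fgx.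
by apply: cvg_trans cf; exact: near_eq_cvg.
Qed.

Section Charts.
Context {R : realType} {d : nat} {M : manifold R d}.
Implicit Types (a b : chart R d M) (h : M -> M) (q : M).

Lemma near_chart_inv a q : dom a q ->
  \forall y \near a q, dom a (chart_inv a y) /\ a (chart_inv a y) = y.
Proof.
move=> aq; have : nbhs (a q) (a @` dom a).
  by apply: open_nbhs_nbhs; split; [exact: open_codom|exists q].
by apply: filterS => _ [u au <-]; rewrite chart_mapK.
Qed.

Lemma chart_inv_cvg a q : dom a q -> chart_inv a y @[y --> a q] --> q.
Proof.
move=> aq; rewrite -[in X in _ --> X](chart_mapK aq).
by apply: chart_inv_continuous; exists q.
Qed.

Lemma near_dom a q : dom a q -> \forall u \near q, dom a u.
Proof. by move=> aq; apply: open_nbhs_nbhs; split => //; exact: open_dom. Qed.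

Lemma near_chart a q (P : set 'rV[R]_d) : dom a q ->
  (\forall y \near a q, P y) -> \forall u \near q, P (a u).
Proof. by move=> aq; apply: chart_map_continuous. Qed.

(** The derivative of [h] at [q], read in the chart [a] at the source and in
    the chart [b] at the target. The matrices [to_tangent] and [mdiff] are both
    of this form, so that the chain rule below relates all of them. *)
Definition jac a b h q : 'M[R]_d := jacobian (b \o h \o chart_inv a) (a q).

Lemma C1_map_differentiable h a b q : C1_map h -> atlas a -> atlas b ->
  dom a q -> dom b (h q) -> differentiable (b \o h \o chart_inv a) (a q).
Proof.
move=> [_ hC] aa ab aq bq; have [+ _] := hC _ _ aa ab; apply.
by exists q.
Qed.

Lemma C1_map_jac_continuous h a b q : C1_map h -> atlas a -> atlas b ->
  dom a q -> dom b (h q) -> {for q, continuous (jac a b h)}.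
Proof.
move=> [hc hC] aa ab aq bq.
have [hd hD] := hC _ _ aa ab.
have nq : \forall y \near a q, (a @` (dom a `&` h @^-1` dom b)) y.
  have nb : \forall u \near q, dom b (h u) by apply: hc; exact: near_dom.
  have := chart_inv_cvg aq nb.
  move=> /= nb'; near=> y.
  have [ay <-] : dom a (chart_inv a y) /\ a (chart_inv a y) = y.
    by near: y; exact: near_chart_inv.
  by exists (chart_inv a y) => //; split => //=; near: y.
have jc : {for a q, continuous (jacobian (b \o h \o chart_inv a))}.
  apply: (@cvg_mxP _ _ (nbhs (a q))) => i j.
  pose g y := ('D_(delta_mx 0 i) (b \o h \o chart_inv a) y) 0 j.
  pose k y := jacobian (b \o h \o chart_inv a) y i j.
  suff : {for a q, continuous k} by [].
  have kg y : (a @` (dom a `&` h @^-1` dom b)) y -> g y = k y.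
    by move=> /hd dy; rewrite /g /k deriveEjacobian// -rowE [LHS]mxE.
  have aqI : (a @` (dom a `&` h @^-1` dom b)) (a q) by exists q.
  apply: (@near_eq_continuous_at _ _ g); first exact: filterS nq.
  exact: (cvg_coord (hD (delta_mx 0 i) (a q) aqI)).
rewrite /jac; apply: continuous_comp => //.
exact: chart_map_continuous.
Unshelve. all: by end_near. Qed.

Lemma jac_comp h1 h2 a b c q : C1_map h1 -> C1_map h2 ->
  atlas a -> atlas b -> atlas c ->
  dom a q -> dom b (h1 q) -> dom c (h2 (h1 q)) ->
  differentiable (c \o (h2 \o h1) \o chart_inv a) (a q) /\
  jac a c (h2 \o h1) q = jac a b h1 q *m jac b c h2 (h1 q).
Proof.
move=> h1C h2C aa ab ac aq bq cq.
have d1 := C1_map_differentiable h1C aa ab aq bq.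
have d2 := C1_map_differentiable h2C ab ac bq cq.
have e1 : (b \o h1 \o chart_inv a) (a q) = b (h1 q) by rewrite /= chart_mapK.
rewrite /jac -e1; rewrite -e1 in d2.
have ne : {near a q, (c \o h2 \o chart_inv b) \o (b \o h1 \o chart_inv a) =1
                     c \o (h2 \o h1) \o chart_inv a}.
  have nb : \forall u \near q, dom b (h1 u) by exact: (h1C.1 q _ (near_dom bq)).
  have nb' : \forall y \near a q, dom b (h1 (chart_inv a y)).
    exact: chart_inv_cvg aq _ nb.
  by apply: filterS nb' => y by1; rewrite /= chart_mapK.
split; last exact: jacobian_comp_near.
by have [] := derive_comp_near d1 d2 ne.
Qed.

Lemma jac_id a q : dom a q -> jac a a id q = 1%:M.
Proof.
move=> aq; apply: jacobian_near_id.
by apply: filterS (near_chart_inv aq) => y [].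
Qed.

Lemma C1_map_id : C1_map (@id M).
Proof.
split=> [q|a b aa ab]; first exact: cvg_id.
exact: (atlas_compat aa ab 1%N).
Qed.

Lemma C1_map_comp h1 h2 : C1_map h1 -> C1_map h2 -> C1_map (h2 \o h1).
Proof.
move=> h1C h2C; split=> [q|a b aa ab].
  by apply: continuous_comp; [exact: h1C.1|exact: h2C.1].
have dh q : dom a q -> dom b (h2 (h1 q)) ->
    differentiable (b \o (h2 \o h1) \o chart_inv a) (a q).
  move=> aq bq.
  by have [] := jac_comp h1C h2C aa (chart_at_atlas (h1 q)) ab aq
    (chart_at_dom (h1 q)) bq.
split=> [_ [q [aq bq] <-]|v _ [q [aq bq] <-]]; first exact: dh.
pose c := chart_at (h1 q).
have ac : atlas c := chart_at_atlas _.
have cq : dom c (h1 q) := chart_at_dom _.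
have nE : \forall u \near q, dom a u /\ dom c (h1 u) /\ dom b (h2 (h1 u)).
  near=> u; split; first by near: u; exact: near_dom.
  split; near: u; first by exact: (h1C.1 q _ (near_dom cq)).
  have : {for q, continuous (h2 \o h1)}.
    by apply: continuous_comp; [exact: h1C.1|exact: h2C.1].
  by apply; exact: near_dom.
pose J u := v *m (jac a c h1 u *m jac c b h2 (h1 u)).
have JE : \forall y \near a q,
    J (chart_inv a y) = 'D_v (b \o (h2 \o h1) \o chart_inv a) y.
  near=> y.
  have [ay [cy by']] : dom a (chart_inv a y) /\ dom c (h1 (chart_inv a y)) /\
      dom b (h2 (h1 (chart_inv a y))).
    by near: y; apply: (chart_inv_cvg aq nE).
  have yE : a (chart_inv a y) = y by near: y; apply: filterS (near_chart_inv aq) => ? [].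
  have [D DE] := jac_comp h1C h2C aa ac ab ay cy by'.
  by rewrite /J -DE /jac -(deriveEjacobian v D) yE.
apply: (@near_eq_continuous_at _ _ (J \o chart_inv a)); first exact: JE.
have : J (chart_inv a y) @[y --> a q] --> J q.
  have cJ : {for q, continuous J}.
    rewrite /continuous_at /J; apply: cvg_mulmx; first exact: cvg_cst.
    apply: cvg_mulmx; first exact: C1_map_jac_continuous.
    apply: (@continuous_comp _ _ _ h1 (jac c b h2)); first exact: h1C.1.
    exact: C1_map_jac_continuous.
  exact: (@cvg_comp _ _ _ (chart_inv a) J _ _ _ (chart_inv_cvg aq) cJ).
by rewrite -[in X in _ --> X -> _](chart_mapK aq).
Unshelve. all: by end_near. Qed.

Lemma C1_map_iter h n : C1_map h -> C1_map (iter n h).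
Proof.
move=> hC; elim: n => [|n IH]; first exact: C1_map_id.
exact: (C1_map_comp IH hC).
Qed.

Lemma to_tangentE a q : to_tangent a q = jac a (chart_at q) id q.
Proof. by []. Qed.

Lemma mdiffE h q : mdiff h q = jac (chart_at q) (chart_at (h q)) h q.
Proof. by []. Qed.

Lemma mdiff_comp h1 h2 q : C1_map h1 -> C1_map h2 ->
  mdiff (h2 \o h1) q = mdiff h1 q *m mdiff h2 (h1 q).
Proof.
move=> h1C h2C; rewrite !mdiffE.
have A := @chart_at_atlas R d M; have D := @chart_at_dom R d M.
exact: (jac_comp h1C h2C (A q) (A (h1 q)) (A (h2 (h1 q))) (D q) (D (h1 q))
  (D (h2 (h1 q)))).2.
Qed.

Lemma mdiff_id q : mdiff (@id M) q = 1%:M.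
Proof. by rewrite mdiffE jac_id//; exact: chart_at_dom. Qed.

Lemma to_tangent_jac a b h q : C1_map h -> atlas a -> atlas b ->
  dom a q -> dom b (h q) ->
  to_tangent a q *m mdiff h q = jac a b h q *m to_tangent b (h q).
Proof.
move=> hC aa ab aq bq; rewrite !to_tangentE mdiffE.
have A := @chart_at_atlas R d M; have D := @chart_at_dom R d M.
have e1 := (jac_comp C1_map_id hC aa (A q) (A (h q)) aq (D q) (D (h q))).2.
have e2 := (jac_comp hC C1_map_id aa ab (A (h q)) aq bq (D (h q))).2.
exact: etrans (esym e1) e2.
Qed.

Lemma to_tangent_unit a q : atlas a -> dom a q -> to_tangent a q \in unitmx.
Proof.
move=> aa aq; have A := @chart_at_atlas R d M; have D := @chart_at_dom R d M.
have e := (jac_comp C1_map_id C1_map_id aa (A q) aa aq (D q) aq).2.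
have e1 : to_tangent a q *m jac (chart_at q) a id q = 1%:M.
  by rewrite -(jac_id aq); exact: esym e.
exact: (mulmx1_unit e1).1.
Qed.

Section Diffeo.
Variables (f finv : M -> M).
Hypotheses (fC : C1_map f) (finvC : C1_map finv).
Hypotheses (fK : cancel f finv) (finvK : cancel finv f).

Lemma mdiff_diffeo q : mdiff f q *m mdiff finv (f q) = 1%:M.
Proof.
have e := mdiff_comp q fC finvC.
have fid : finv \o f = id by apply/funext => u /=; rewrite fK.
by rewrite -e fid mdiff_id.
Qed.

Lemma mdiff_unit q : mdiff f q \in unitmx.
Proof. exact: (mulmx1_unit (mdiff_diffeo q)).1. Qed.

Lemma invmx_mdiff q : invmx (mdiff f q) = mdiff finv (f q).
Proof.
by rewrite -[LHS]mulmx1 -(mdiff_diffeo q) mulKmx// mdiff_unit.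
Qed.

End Diffeo.
End Charts.

(** * The Riemannian norm and operator norms *)

Section Norms.
Context {R : realType} {d : nat} {M : manifold R d}.
Variable G : riemannian_metric M.
Implicit Types (a b : chart R d M) (q x y : M) (v w : 'rV[R]_d).

(** The Gram matrix of the metric at [q] in the coordinates of the chart [a]. *)
Definition chart_gram a q : 'M[R]_d :=
  to_tangent a q *m gram G q *m (to_tangent a q)^T.

Lemma tnormE q v : tnorm G q v = Num.sqrt (qform (gram G q) v).
Proof. by []. Qed.

Lemma gram_pd q : posdef (gram G q).
Proof. by move=> w; exact: gram_posdef. Qed.

Lemma qform_gram_ge0 q v : 0 <= qform (gram G q) v.
Proof.
have [->|/gram_pd/ltW//] := eqVneq v 0.
by rewrite /qform !mul0mx mxE.
Qed.

Lemma tnorm_sqr q v : tnorm G q v ^+ 2 = qform (gram G q) v.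
Proof. by rewrite tnormE sqr_sqrtr// qform_gram_ge0. Qed.

Lemma tnorm_ge0 q v : 0 <= tnorm G q v.
Proof. exact: sqrtr_ge0. Qed.

Lemma tnorm_gt0 q v : v != 0 -> 0 < tnorm G q v.
Proof. by move=> v0; rewrite tnormE sqrtr_gt0; exact: gram_pd. Qed.

Lemma tnormZ q k v : tnorm G q (k *: v) = `|k| * tnorm G q v.
Proof. by rewrite !tnormE qformZ sqrtrM ?sqr_ge0// sqrtr_sqr. Qed.

Lemma tnorm0 q : tnorm G q 0 = 0.
Proof. by rewrite -[0 in LHS](scale0r 0) tnormZ normr0 mul0r. Qed.

Lemma tnorm_chart_sqr a q w :
  tnorm G q (w *m to_tangent a q) ^+ 2 = qform (chart_gram a q) w.
Proof. by rewrite tnorm_sqr qform_congr. Qed.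

Lemma chart_gram_continuous a q : atlas a -> dom a q ->
  {for q, continuous (chart_gram a)}.
Proof.
move=> aa aq.
pose g (z : 'rV[R]_d) := chart_gram a (chart_inv a z).
have gc : {for a q, continuous g}.
  have aI : (a @` dom a) (a q) by exists q.
  have H := gram_smooth G aa 0%N.
  exact: H _ aI.
apply: (@near_eq_continuous_at _ _ (g \o a)).
  by apply: filterS (near_dom aq) => u au; rewrite /g /= chart_mapK.
by apply: continuous_comp => //; exact: chart_map_continuous.
Qed.

Lemma mulmx_unit_neq0 (A : 'M[R]_d) w : A \in unitmx -> w != 0 -> w *m A != 0.
Proof.
move=> uA; apply: contra_neq => wA.
by rewrite -(mulmxK uA w) wA mul0mx.
Qed.

Lemma posdef_congr (J Q : 'M[R]_d) :
  J \in unitmx -> posdef Q -> posdef (J *m Q *m J^T).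
Proof.
by move=> uJ Qpd w w0; rewrite qform_congr; apply: Qpd; exact: mulmx_unit_neq0.
Qed.

Lemma chart_gram_pd a q : atlas a -> dom a q -> posdef (chart_gram a q).
Proof.
by move=> aa aq; apply: posdef_congr; [exact: to_tangent_unit|exact: gram_pd].
Qed.

Lemma tnorm_mul_bounded x y (A : 'M[R]_d) :
  exists2 K, 0 <= K & forall v, tnorm G y (v *m A) <= K * tnorm G x v.
Proof.
have [c c0 cP] := posdef_ge_norm (@gram_pd x).
pose B := A *m gram G y *m A^T.
pose L := (d%:R ^+ 2 * `|B|).
have L0 : 0 <= L by rewrite mulr_ge0// sqr_ge0.
exists (Num.sqrt (L / c)); first exact: sqrtr_ge0.
move=> v; rewrite !tnormE -qform_congr -sqrtrM; last by rewrite divr_ge0// ltW.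
apply: ler_wsqrtr.
rewrite (le_trans (ler_norm _))// (le_trans (qform_le_norm _ _))// -/B -/L.
by rewrite -[leRHS]mulrA ler_wpM2l// ler_pdivlMl.
Qed.

Let opnorm_set x y (A : 'M[R]_d) :=
  [set tnorm G y (v *m A) | v in [set v | tnorm G x v <= 1]].

Lemma opnorm_has_sup x y (A : 'M[R]_d) : has_sup (opnorm_set x y A).
Proof.
split; first by exists (tnorm G y (0 *m A)), 0 => //=; rewrite tnorm0.
have [K K0 KP] := tnorm_mul_bounded x y A.
exists K => _ [v /= v1 <-]; rewrite (le_trans (KP v))//.
by rewrite ler_piMr.
Qed.

Lemma tnorm_mul_le x y (A : 'M[R]_d) v :
  tnorm G y (v *m A) <= opnorm G x y A * tnorm G x v.
Proof.
have [->|v0] := eqVneq v 0; first by rewrite mul0mx !tnorm0 mulr0.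
have n0 := tnorm_gt0 x v0.
rewrite -ler_pdivrMr//.
apply: (sup_upper_bound (opnorm_has_sup x y A)).
exists ((tnorm G x v)^-1 *: v) => /=.
  by rewrite tnormZ normfV ger0_norm ?tnorm_ge0// mulVf// gt_eqF.
by rewrite -scalemxAl tnormZ normfV ger0_norm ?tnorm_ge0// mulrC.
Qed.

Lemma opnorm_le x y (A : 'M[R]_d) K : 0 <= K ->
  (forall v, tnorm G y (v *m A) <= K * tnorm G x v) -> opnorm G x y A <= K.
Proof.
move=> K0 KP; apply: ge_sup; first exact: (opnorm_has_sup x y A).1.
by move=> _ [v /= v1 <-]; rewrite (le_trans (KP v))// ler_piMr.
Qed.

Lemma opnorm_ge0 x y (A : 'M[R]_d) : 0 <= opnorm G x y A.
Proof.
apply: (sup_upper_bound (opnorm_has_sup x y A)).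
by exists 0; rewrite /= ?mul0mx tnorm0.
Qed.

Lemma opnorm_gt0 x y (A : 'M[R]_d) :
  (0 < d)%N -> A \in unitmx -> 0 < opnorm G x y A.
Proof.
move=> d0 uA; pose e : 'rV[R]_d := const_mx 1.
have e0 : e != 0.
  apply/eqP => /matrixP/(_ 0 (Ordinal d0)); rewrite !mxE => /eqP.
  by rewrite oner_eq0.
have := lt_le_trans (tnorm_gt0 y (mulmx_unit_neq0 uA e0)) (tnorm_mul_le x y A e).
by rewrite pmulr_lgt0// tnorm_gt0.
Qed.

(** For [h] the inverse of an iterate of the diffeomorphism, the exponent is an
    average of the logarithm of this norm along the orbit. *)
Definition diff_norm (h : M -> M) q : R := opnorm G q (h q) (mdiff h q).

Lemma tnorm_mdiff_sqr h a b q w : C1_map h -> atlas a -> atlas b ->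
  dom a q -> dom b (h q) ->
  tnorm G (h q) (w *m to_tangent a q *m mdiff h q) ^+ 2 =
  qform (jac a b h q *m chart_gram b (h q) *m (jac a b h q)^T) w.
Proof.
move=> hC aa ab aq bq.
have e : w *m to_tangent a q *m mdiff h q =
    w *m jac a b h q *m to_tangent b (h q).
  have e0 := congr1 (mulmx w) (to_tangent_jac hC aa ab aq bq).
  exact: etrans (etrans (esym (mulmxA w _ _)) e0) (mulmxA w _ _).
rewrite e (tnorm_chart_sqr b (h q) (w *m jac a b h q)).
exact: esym (qform_congr _ _ _).
Qed.

Lemma tangent_chart v a q : atlas a -> dom a q ->
  exists w, v = w *m to_tangent a q.
Proof.
move=> aa aq; exists (v *m invmx (to_tangent a q)).
exact: esym (mulmxKV (to_tangent_unit aa aq) v).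
Qed.

(** In charts the norm of the derivative is the square root of a supremum of
    quotients of two positive definite forms that vary continuously, so that
    pinching both forms pinches the supremum. *)
Lemma diff_norm_near h y e : C1_map h -> mdiff h y \in unitmx -> 0 < e ->
  \forall q \near y, diff_norm h q <= (1 + e) * diff_norm h y /\
    diff_norm h y <= (1 + e) * diff_norm h q.
Proof.
move=> hC uh e0.
have pinch (hq hr tq tr n A B A' B' : R) : 0 <= hq -> 0 <= hr -> 0 <= tq ->
    0 <= tr -> 0 <= n -> hq ^+ 2 = A -> hr ^+ 2 = B -> tq ^+ 2 = A' ->
    tr ^+ 2 = B' -> A <= (1 + e) * B -> B' <= (1 + e) * A' ->
    hr <= n * tr -> hq <= (1 + e) * n * tq.
  move=> hq0 hr0 tq0 tr0 n0 <- <- <- <- hqr trq hrn.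
  have e1 : 0 < 1 + e by rewrite addr_gt0.
  have p0 : 0 <= (1 + e) * n * tq by rewrite !mulr_ge0// ltW.
  rewrite -(@ler_pXn2r _ 2)// (le_trans hqr)// !exprMn [(1 + e) ^+ 2]expr2.
  rewrite -!mulrA ler_pM2l//.
  have : hr ^+ 2 <= n ^+ 2 * tr ^+ 2.
    by rewrite -exprMn ler_pXn2r// nnegrE mulr_ge0.
  by have := ler_wpM2l (sqr_ge0 n) trq; lra.
pose a := chart_at y; pose b := chart_at (h y).
have aa : atlas a := chart_at_atlas _.
have ab : atlas b := chart_at_atlas _.
have ay : dom a y := chart_at_dom _.
have by' : dom b (h y) := chart_at_dom _.
pose Q2 q := jac a b h q *m chart_gram b (h q) *m (jac a b h q)^T.
have jc := C1_map_jac_continuous hC aa ab ay by'.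
have Q2c : {for y, continuous Q2}.
  apply: cvg_mulmx; last exact: cvg_trmx.
  apply: cvg_mulmx => //.
  apply: (@continuous_comp _ _ _ h (chart_gram b)); first exact: hC.1.
  exact: chart_gram_continuous.
have Q2pd : posdef (Q2 y).
  apply: posdef_congr; last exact: chart_gram_pd.
  by rewrite /jac -/(mdiff h y).
have near1 := qform_near (chart_gram_continuous aa ay) (chart_gram_pd aa ay) e0.
have near2 := qform_near Q2c Q2pd e0.
have nearb : \forall q \near y, dom b (h q) by exact: (hC.1 y _ (near_dom by')).
have e1 : 0 < 1 + e by rewrite addr_gt0.
have key q r : dom a q -> dom b (h q) -> dom a r -> dom b (h r) ->
    (forall w, qform (Q2 q) w <= (1 + e) * qform (Q2 r) w) ->
    (forall w, qform (chart_gram a r) w <= (1 + e) * qform (chart_gram a q) w) ->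
    diff_norm h q <= (1 + e) * diff_norm h r.
  move=> aq bq ar br h2 h1.
  have n0 : 0 <= (1 + e) * diff_norm h r by rewrite mulr_ge0 ?opnorm_ge0// ltW.
  apply: opnorm_le => // v.
  have [w ->] := tangent_chart v aa aq.
  have hq := tnorm_mdiff_sqr w hC aa ab aq bq.
  have hr := tnorm_mdiff_sqr w hC aa ab ar br.
  have gq := tnorm_chart_sqr a q w.
  have gr := tnorm_chart_sqr a r w.
  have le_r := tnorm_mul_le r (h r) (mdiff h r) (w *m to_tangent a r).
  have q0 := tnorm_ge0 q (w *m to_tangent a q).
  have r0 := tnorm_ge0 r (w *m to_tangent a r).
  have hq0 := tnorm_ge0 (h q) (w *m to_tangent a q *m mdiff h q).
  have hr0 := tnorm_ge0 (h r) (w *m to_tangent a r *m mdiff h r).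
  have nr0 : 0 <= diff_norm h r := opnorm_ge0 _ _ _.
  exact: (pinch _ _ _ _ _ _ _ _ _ hq0 hr0 q0 r0 nr0 hq hr gq gr (h2 w) (h1 w) le_r).
clearbody Q2.
near=> q.
have aq : dom a q by near: q; exact: near_dom.
have bq : dom b (h q) by near: q; exact: nearb.
have n1 : forall w, qform (chart_gram a y) w <= (1 + e) * qform (chart_gram a q) w /\
    qform (chart_gram a q) w <= (1 + e) * qform (chart_gram a y) w.
  by near: q; exact: near1.
have n2 : forall w, qform (Q2 y) w <= (1 + e) * qform (Q2 q) w /\
    qform (Q2 q) w <= (1 + e) * qform (Q2 y) w.
  by near: q; exact: near2.
split.
  by apply: key => // w; [exact: (n2 w).2|exact: (n1 w).1].
by apply: key => // w; [exact: (n2 w).1|exact: (n1 w).2].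
Unshelve. all: by end_near. Qed.

Lemma tnorm_chart_near a p : atlas a -> dom a p ->
  exists c C : R, [/\ 0 < c, 0 < C & \forall q \near p, forall w,
    c * `|w| <= tnorm G q (w *m to_tangent a q) /\
    tnorm G q (w *m to_tangent a q) <= C * `|w|].
Proof.
move=> aa ap.
have [c c0 cP] := posdef_ge_norm (chart_gram_pd aa ap).
pose K : R := d%:R ^+ 2 * `|chart_gram a p| + 1.
have K0 : 0 < K by rewrite ltr_wpDl// mulr_ge0// sqr_ge0.
have pinch (t A B u D : R) : 0 <= t -> 0 <= u -> t ^+ 2 = A -> D + 1 = K ->
    B <= (1 + 1) * A -> A <= (1 + 1) * B -> c * u ^+ 2 <= B ->
    B <= D * u ^+ 2 ->
    Num.sqrt (c / 2) * u <= t /\ t <= Num.sqrt (2 * K) * u.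
  move=> t0 u0 tA DK AB BA cB BD.
  have s0 : 0 <= c / 2 by rewrite divr_ge0// ltW.
  have s1 : 0 <= 2 * K by rewrite mulr_ge0// ltW.
  have u2 : 0 <= u ^+ 2 by rewrite sqr_ge0.
  have KE : K * u ^+ 2 = D * u ^+ 2 + u ^+ 2 by rewrite -DK; ring.
  split; rewrite -(@ler_pXn2r _ 2)// ?nnegrE ?mulr_ge0 ?sqrtr_ge0//;
    by rewrite exprMn sqr_sqrtr// tA; lra.
exists (Num.sqrt (c / 2)), (Num.sqrt (2 * K)).
split; rewrite ?sqrtr_gt0 ?mulr_gt0 ?divr_gt0//.
have := qform_near (chart_gram_continuous aa ap) (chart_gram_pd aa ap) (@ltr01 R).
apply: filterS => q qP w.
exact: (pinch _ _ _ _ _ (tnorm_ge0 q _) (normr_ge0 w) (tnorm_chart_sqr a q w)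
  erefl (qP w).1 (qP w).2 (cP w)
  (le_trans (ler_norm _) (qform_le_norm (chart_gram a p) w))).
Qed.

End Norms.

(** * Lengths of curves *)

Lemma le_Rintegral_scaled (R : realType) (f g : R -> R) (K a b : R) :
  lebesgue_measure.-integrable `[a, b] (EFin \o f) ->
  lebesgue_measure.-integrable `[a, b] (EFin \o g) ->
  (forall t, a <= t <= b -> f t <= K * g t) ->
  \int[lebesgue_measure]_(t in `[a, b]) f t <=
  K * \int[lebesgue_measure]_(t in `[a, b]) g t.
Proof.
move=> fi gi fg; rewrite -RintegralZl//; apply: le_Rintegral => //.
exact: (@integrableZl _ _ _ _ _ _ K _ gi).
Qed.

Section Curves.
Context {R : realType} {d : nat} {M : manifold R d}.
Variable G : riemannian_metric M.
Implicit Types (a b : chart R d M) (h : M -> M) (c : R -> M) (t : R).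

Definition curve_on (U : set R) c : Prop :=
  [/\ open U, forall t, U t -> {for t, continuous c} &
    forall a, atlas a -> Ck 1 (U `&` c @^-1` dom a) (a \o c)].

Lemma curve_on_derive U c h a b t : curve_on U c -> C1_map h ->
  atlas a -> atlas b -> U t -> dom a (c t) -> dom b (h (c t)) ->
  differentiable (b \o h \o c) t /\
  'D_1 (b \o h \o c) t = 'D_1 (a \o c) t *m jac a b h (c t).
Proof.
move=> [oU cc cC] hC aa ab Ut act bct.
have [dc _] := cC _ aa.
have d1 : differentiable (a \o c) t by exact: dc.
have d2 := C1_map_differentiable hC aa ab act bct.
have e : {near t, (b \o h \o chart_inv a) \o (a \o c) =1 b \o h \o c}.
  have na : \forall s \near t, dom a (c s) by exact: (cc t Ut _ (near_dom act)).
  by apply: filterS na => s acs; rewrite /= chart_mapK.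
have [D DE] := derive_comp_near d1 d2 e.
by split => //; rewrite DE.
Qed.

Lemma curve_on_comp U c h : curve_on U c -> C1_map h -> curve_on U (h \o c).
Proof.
move=> cU hC; have [oU cc cC] := cU; split => //.
  move=> t Ut; apply: continuous_comp; first exact: cc.
  exact: hC.1.
move=> b ab; split=> [t [Ut bt]|v t [Ut bt]].
  exact: (curve_on_derive cU hC (chart_at_atlas (c t)) ab Ut (chart_at_dom _) bt).1.
pose a := chart_at (c t).
have aa : atlas a := chart_at_atlas _.
have act : dom a (c t) := chart_at_dom _.
pose J s := 'D_v (a \o c) s *m jac a b h (c s).
have nU : nbhs t U by exact: open_nbhs_nbhs.
have na : \forall s \near t, dom a (c s) by exact: (cc t Ut _ (near_dom act)).
have hcc : {for t, continuous (h \o c)}.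
  by apply: continuous_comp; [exact: cc|exact: hC.1].
have nb : \forall s \near t, dom b (h (c s)) by exact: (hcc _ (near_dom bt)).
apply: (@near_eq_continuous_at _ _ J).
  apply: filterS3 nU na nb => s Us as' bs.
  have [D DE] := curve_on_derive cU hC aa ab Us as' bs.
  have [D' _] : (forall s, (U `&` c @^-1` dom a) s -> differentiable (a \o c) s) /\ True.
    by split => //; exact: (cC _ aa).1.
  have e1 : v = v *: (1 : R) by rewrite /GRing.scale /= mulr1.
  have E (W : normedModType R) (k : R -> W) : differentiable k s ->
      'D_v k s = v *: 'D_1 k s.
    by move=> dk; rewrite !deriveE// [in LHS]e1 linearZ.
  rewrite /J (E _ _ (D' _ (conj Us as'))) -scalemxAl.
  by rewrite -DE (E _ (b \o (h \o c)) D).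
have c1 : {for t, continuous ('D_v (a \o c))} by exact: (cC _ aa).2.
have c2 : {for t, continuous (jac a b h \o c)}.
  apply: continuous_comp; first exact: cc.
  exact: C1_map_jac_continuous.
exact: (cvg_mulmx c1 c2).
Qed.

Lemma velocity_comp U c h t : curve_on U c -> C1_map h -> U t ->
  velocity (h \o c) t = velocity c t *m mdiff h (c t).
Proof.
move=> cU hC Ut.
exact: (curve_on_derive cU hC (chart_at_atlas (c t)) (chart_at_atlas (h (c t)))
  Ut (chart_at_dom _) (chart_at_dom _)).2.
Qed.

Lemma velocity_chart U c a t : curve_on U c -> atlas a -> U t ->
  dom a (c t) -> velocity c t = 'D_1 (a \o c) t *m to_tangent a (c t).
Proof.
move=> cU aa Ut act.
exact: (curve_on_derive cU C1_map_id aa (chart_at_atlas (c t))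
  Ut act (chart_at_dom _)).2.
Qed.

Definition speed c t : R := tnorm G (c t) (velocity c t).

Lemma speed_ge0 c t : 0 <= speed c t.
Proof. exact: tnorm_ge0. Qed.

(** The velocity is expressed in a chart that jumps along the curve; the speed
    is nevertheless continuous because it can be computed in a fixed chart. *)
Lemma speed_continuous U c t : curve_on U c -> U t ->
  {for t, continuous (speed c)}.
Proof.
move=> cU Ut; have [oU cc cC] := cU.
pose a := chart_at (c t).
have aa : atlas a := chart_at_atlas _.
have act : dom a (c t) := chart_at_dom _.
pose g s := Num.sqrt (qform (chart_gram G a (c s)) ('D_1 (a \o c) s)).
have nU : nbhs t U by exact: open_nbhs_nbhs.
have na : \forall s \near t, dom a (c s) by exact: (cc t Ut _ (near_dom act)).
apply: (@near_eq_continuous_at _ _ g).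
  apply: filterS2 nU na => s Us as'.
  rewrite /g /speed (velocity_chart cU aa Us as') -tnorm_chart_sqr.
  by rewrite sqrtr_sqr ger0_norm// tnorm_ge0.
have c1 : {for t, continuous ('D_1 (a \o c))} by exact: (cC _ aa).2.
have c2 : {for t, continuous (chart_gram G a \o c)}.
  apply: continuous_comp; first exact: cc.
  exact: chart_gram_continuous.
have c3 := cvg_qform c2 c1.
apply: (continuous_comp (f := fun s => qform (chart_gram G a (c s)) ('D_1 (a \o c) s))).
  exact: c3.
exact: sqrt_continuous.
Qed.

Lemma speed_integrable U c s : curve_on U c -> `[0, s] `<=` U ->
  lebesgue_measure.-integrable `[0, s] (EFin \o speed c).
Proof.
move=> cU sU; apply: continuous_compact_integrable; first exact: segment_compact.
apply: continuous_in_subspaceT => t; rewrite inE => ts.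
by apply: (speed_continuous cU); exact: sU.
Qed.

Lemma curve_length_ge0 c : 0 <= curve_length G c.
Proof. by apply: Rintegral_ge0 => t _; exact: speed_ge0. Qed.

Lemma curve_length_comp U c h K : curve_on U c -> `[0, 1] `<=` U -> C1_map h ->
  (forall t, 0 <= t <= 1 -> diff_norm G h (c t) <= K) ->
  curve_length G (h \o c) <= K * curve_length G c.
Proof.
move=> cU U01 hC hK.
have iC := speed_integrable cU U01.
have iH := speed_integrable (curve_on_comp cU hC) U01.
apply: (le_Rintegral_scaled iH iC) => t t01.
have Ut : U t by apply: U01; rewrite /= in_itv.
rewrite /speed (velocity_comp cU hC Ut).
apply: le_trans (tnorm_mul_le G _ _ _ _) _.
by apply: ler_wpM2r; [exact: tnorm_ge0|exact: hK].
Qed.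

End Curves.

Section Displacement.
Context {R : realType}.

Lemma Rintegral_le_FTC (F f g : R -> R) (K s : R) : 0 < s ->
  (forall t : R, 0 <= t <= s -> derivable F t 1 /\ 'D_1 F t = f t) ->
  (forall t : R, 0 <= t <= s -> {for t, continuous f}) ->
  (forall t : R, 0 <= t <= s -> f t <= K * g t) ->
  lebesgue_measure.-integrable `[0, s] (EFin \o g) ->
  F s - F 0 <= K * \int[lebesgue_measure]_(t in `[0, s]) g t.
Proof.
move=> s0 Fd fc fg gi.
have fw : {within `[0, s], continuous f}.
  apply: continuous_in_subspaceT => t; rewrite inE /= in_itv; exact: fc.
have Fc (t : R) : 0 <= t <= s -> {for t, continuous F}.
  move=> /Fd[dF _]; apply: differentiable_continuous.
  exact/derivable1_diffP.
have FTC : (\int[lebesgue_measure]_(x in `[0%R, s]) (f x)%:E = (F s)%:E - (F 0%R)%:E)%E.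
  apply: continuous_FTC2 => //.
    split.
    - by move=> t; rewrite in_itv => /andP[t0 ts]; apply: (Fd t _).1; rewrite !ltW.
    - by apply: cvg_at_right_filter; apply: Fc; rewrite lexx ltW.
    - by apply: cvg_at_left_filter; apply: Fc; rewrite lexx ltW.
  move=> t; rewrite in_itv => /andP[t0 ts].
  by rewrite derive1E; apply: (Fd t _).2; rewrite !ltW.
have -> : F s - F 0 = \int[lebesgue_measure]_(t in `[0, s]) f t.
  by rewrite /Rintegral FTC.
apply: le_Rintegral_scaled => //.
by apply: continuous_compact_integrable => //; exact: segment_compact.
Qed.

Lemma Rintegral_ge0_subitv (g : R -> R) (s : R) : 0 <= s <= 1 ->
  (forall t : R, 0 <= g t) ->
  lebesgue_measure.-integrable `[0, 1] (EFin \o g) ->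
  \int[lebesgue_measure]_(t in `[0, s]) g t <=
  \int[lebesgue_measure]_(t in `[0, 1]) g t.
Proof.
move=> /andP[s0 s1] g0 gi; rewrite -subr_ge0 Rintegral_itvB//.
by apply: Rintegral_ge0.
Qed.

Context {d : nat} {M : manifold R d}.
Variable G : riemannian_metric M.

(** The fundamental theorem of calculus is applied to each coordinate; nothing
    is lost, since the norm on row vectors is the sup norm. *)
Lemma chart_displacement U (c : R -> M) (a : chart R d M) k s :
  curve_on U c -> `[0, 1] `<=` U -> atlas a -> 0 < k -> 0 <= s <= 1 ->
  (forall t : R, 0 <= t <= s -> dom a (c t) /\
    forall w, k * `|w| <= tnorm G (c t) (w *m to_tangent a (c t))) ->
  k * `|a (c s) - a (c 0)| <= curve_length G c.
Proof.
move=> cU U01 aa k0 /andP[s0 s1] hk.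
have [oU cc cC] := cU.
have [s00|sn0] := eqVneq s 0.
  by rewrite s00 subrr normr0 mulr0; exact: curve_length_ge0.
have sp : 0 < s by rewrite lt_neqAle eq_sym sn0.
have tU t : 0 <= t <= s -> U t.
  by move=> /andP[t0 ts]; apply: U01; rewrite /= in_itv /= t0 (le_trans ts).
rewrite -ler_pdivlMl//; apply: norm_le_coord.
  by rewrite mulr_ge0 ?curve_length_ge0// invr_ge0 ltW.
move=> i j; rewrite (ord1 i) mxE [(- _ : 'rV__) _ _]mxE.
have gi := speed_integrable G cU U01.
have gs : lebesgue_measure.-integrable `[0, s] (EFin \o speed G c).
  by apply: integrableS gi => //; apply: subset_itvl; rewrite bnd_simp.
have ints : \int[lebesgue_measure]_(t in `[0, s]) speed G c t <= curve_length G c.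
  by apply: Rintegral_ge0_subitv => //; [rewrite s0|move=> t; exact: speed_ge0].
pose F t := a (c t) 0 j; pose f t := ('D_1 (a \o c) t) 0 j.
have dF t : 0 <= t <= s -> derivable F t 1 /\ 'D_1 F t = f t.
  move=> ts; have [act _] := hk t ts.
  have dc : derivable (a \o c) t 1.
    by apply: diff_derivable; apply: (cC _ aa).1; split => //; exact: tU.
  split; first by have /derivable_mxP := dc; apply.
  by rewrite /f derive_mx// mxE.
have cf t : 0 <= t <= s -> {for t, continuous f}.
  move=> ts; have [act _] := hk t ts.
  have c1 : {for t, continuous ('D_1 (a \o c))}.
    by apply: (cC _ aa).2; split => //; exact: tU.
  exact: (cvg_coord c1).
have fg t : 0 <= t <= s -> `|f t| <= k^-1 * speed G c t.
  move=> ts; have [act kw] := hk t ts.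
  rewrite ler_pdivlMl// /speed (velocity_chart cU aa (tU t ts) act).
  by apply: le_trans (kw _); rewrite ler_wpM2l ?coord_le_norm// ltW.
have kV : 0 <= k^-1 by rewrite invr_ge0 ltW.
apply: (@le_trans _ _ (k^-1 * \int[lebesgue_measure]_(t in `[0, s]) speed G c t));
  last by rewrite ler_wpM2l.
rewrite ler_norml lerNl opprB; apply/andP; split.
  have -> : a (c 0) 0 j - a (c s) 0 j = (- F) s - (- F) 0.
    by rewrite /F /= !fctE opprK addrC.
  apply: (@Rintegral_le_FTC (- F) (- f)) => // t ts.
  - have [D DE] := dF t ts; split; first exact: derivableN.
    by rewrite deriveN// DE.
  - by apply: continuousN; exact: cf.
  - by apply: le_trans (fg t ts); rewrite -normrN ler_norm.
apply: (@Rintegral_le_FTC F f) => // t ts.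
by apply: le_trans (fg t ts); rewrite ler_norm.
Qed.

End Displacement.

(** * The distance in charts *)

Section NormBalls.
Context {R : realType} {n : nat}.
Implicit Types (z : 'rV[R]_n) (r : R).

Let dist_norm_continuous z : continuous (fun y : 'rV[R]_n => `|y - z|).
Proof.
move=> y; apply: (continuous_comp (f := fun y : 'rV[R]_n => y - z)).
  exact: (@cvgB _ _ _ (nbhs y) _ id (fun=> z) y z cvg_id (cvg_cst z)).
exact (@norm_continuous _ _ (y - z)).
Qed.

Lemma open_norm_lt z r : open [set y : 'rV[R]_n | `|y - z| < r].
Proof.
apply: (@open_comp _ _ (fun y : 'rV[R]_n => `|y - z|) [set x | x < r]);
  last exact: open_lt.
by move=> y _; exact: dist_norm_continuous.
Qed.

Lemma closed_norm_le z r : closed [set y : 'rV[R]_n | `|y - z| <= r].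
Proof.
apply: (@preimage_closed _ _ (fun y : 'rV[R]_n => `|y - z|) [set x | x <= r]).
  by move=> y _; exact: dist_norm_continuous.
exact: closed_le.
Qed.

End NormBalls.

Section Distance.
Context {R : realType} {d : nat} {M : manifold R d}.
Variable G : riemannian_metric M.
Implicit Types (a b : chart R d M) (h : M -> M) (c : R -> M) (p q u : M).

Lemma chart_ball a p (P : M -> Prop) : dom a p -> (\forall q \near p, P q) ->
  exists2 r : R, 0 < r & forall y, `|y - a p| < r ->
    [/\ dom a (chart_inv a y), a (chart_inv a y) = y & P (chart_inv a y)].
Proof.
move=> ap nP.
have n1 := near_chart_inv ap.
have n2 : \forall y \near a p, P (chart_inv a y) by exact: (chart_inv_cvg ap nP).
have /nbhs_ballP[r r0 rP] : nbhs (a p) [set y | (dom a (chart_inv a y) /\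
    a (chart_inv a y) = y) /\ P (chart_inv a y)] by exact: filterI.
exists r => // y yr; have [] := rP y; last by move=> [? ?] ?; split.
by rewrite -ball_normE /= distrC.
Qed.

Lemma joined_ge0 p q l : joined G p q l -> 0 <= l.
Proof. by elim=> [//|c {}q {}l _ _ l0]; rewrite addr_ge0// curve_length_ge0. Qed.

Lemma joined_trans p q u l l' :
  joined G p q l -> joined G q u l' -> joined G p u (l + l').
Proof.
elim=> [{}p|c {}q {}l cC _ IH] qu; first by rewrite add0r.
by rewrite -addrA; apply: joined_cons => //; exact: IH.
Qed.

Lemma joined1 c : C1_curve c -> joined G (c 0) (c 1) (curve_length G c).
Proof.
move=> cC; rewrite -[X in joined _ _ _ X]addr0.
by apply: joined_cons => //; exact: joined_refl.
Qed.

Lemma joined_chart_segment a p r C : atlas a -> 0 < C ->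
  (forall y, `|y - a p| < r -> [/\ dom a (chart_inv a y), a (chart_inv a y) = y &
    forall w, tnorm G (chart_inv a y) (w *m to_tangent a (chart_inv a y))
      <= C * `|w|]) ->
  forall y z, `|y - a p| < r -> `|z - a p| < r ->
  exists2 l, joined G (chart_inv a y) (chart_inv a z) l & l <= C * `|z - y|.
Proof.
move=> aa C0 rP y z yr zr.
pose w := z - y; pose g (t : R) := y + t *: w; pose c := chart_inv a \o g.
pose U := [set t : R | `|g t - a p| < r].
have gc : continuous g.
  by move=> t; apply: cvgD; [exact: cvg_cst|apply: cvgZr_tmp; exact: cvg_id].
have oU : open U.
  apply: (@open_comp _ _ g [set y | `|y - a p| < r]); last exact: open_norm_lt.
  by move=> t _; exact: gc.
have U01 : `[0, 1] `<=` U.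
  move=> t; rewrite /= in_itv /= => /andP[t0 t1]; rewrite /U /= /g.
  have -> : y + t *: w - a p = (1 - t) *: (y - a p) + t *: (z - a p).
    by rewrite /w; apply/rowP => j; rewrite !mxE; ring.
  rewrite (le_lt_trans (ler_normD _ _))// !normrZ (ger0_norm t0) ger0_norm ?subr_ge0//.
  have [->|tn0] := eqVneq t 0; first by rewrite subr0 mul1r mul0r addr0.
  have tp : 0 < t by rewrite lt_neqAle eq_sym tn0.
  apply: (@lt_le_trans _ _ ((1 - t) * r + t * r)); last by rewrite -mulrDl subrK mul1r.
  by rewrite ler_ltD// ?ltr_pM2l// ler_wpM2l ?subr_ge0// ltW.
have cdom t : U t -> dom a (c t) by move=> /rP[].
have cg t : U t -> a (c t) = g t by move=> /rP[].
have dg t v : differentiable g t /\ 'D_v g t = v *: w.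
  have D : is_diff t g (cst 0 + *:%R^~ w).
    exact: (is_diffD (is_diff_cst y t) (is_diff_scalel t w)).
  have D' : differentiable g t by exact: ex_diff.
  by split => //; rewrite deriveE// diff_val !fctE add0r.
have cc t : U t -> {for t, continuous c}.
  move=> Ut; apply: continuous_comp; first exact: gc.
  by apply: chart_inv_continuous; exists (c t); [exact: cdom|exact: cg].
have dbc b t v : atlas b -> U t -> dom b (c t) ->
    differentiable (b \o c) t /\ 'D_v (b \o c) t = (v *: w) *m jac a b id (c t).
  move=> ab Ut bct.
  have d2 := C1_map_differentiable C1_map_id aa ab (cdom t Ut) bct.
  rewrite /= cg// in d2.
  have e : {near t, (b \o id \o chart_inv a) \o g =1 b \o c}
    by apply: (@filterE _ (nbhs t) (nbhs_filter t)) => s.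
  have [D DE] := derive_comp_near (dg t 0).1 d2 e.
  have Je := congr1 (jacobian (b \o id \o chart_inv a)) (cg t Ut).
  split; first exact: D.
  apply: etrans (DE v) _; rewrite (dg t v).2.
  by rewrite /jac Je.
have cU : curve_on U c.
  split=> // b ab; split=> [t [Ut bt]|v t [Ut bt]]; first exact: (dbc b t 0 ab Ut bt).1.
  pose J s := (v *: w) *m jac a b id (c s).
  apply: (@near_eq_continuous_at _ _ J).
    have nU : nbhs t U by exact: open_nbhs_nbhs.
    have nb : \forall s \near t, dom b (c s) by exact: (cc t Ut _ (near_dom bt)).
    by apply: filterS2 nU nb => s Us bs; rewrite (dbc b s v ab Us bs).2.
  have c1 : {for t, continuous (jac a b id \o c)}.
    apply: continuous_comp; first exact: cc.
    by apply: C1_map_jac_continuous => //; [exact: C1_map_id|exact: cdom].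
  exact: (cvg_mulmx (cvg_cst _) c1).
have [g0 g1] : g 0 = y /\ g 1 = z.
  by rewrite /g scale0r addr0 scale1r /w addrC subrK.
exists (curve_length G c).
  rewrite -g0 -g1 -[chart_inv a (g 0)]/(c 0) -[chart_inv a (g 1)]/(c 1).
  apply: joined1; exists U; have [? ? ?] := cU; split => //.
have il := speed_integrable G cU U01.
have i1 : lebesgue_measure.-integrable `[(0:R), 1] (EFin \o cst 1).
  apply: continuous_compact_integrable; first exact: segment_compact.
  by apply: continuous_subspaceT => t; exact: cvg_cst.
have -> : C * `|z - y| = (C * `|z - y|) *
    \int[lebesgue_measure]_(t in `[(0:R), 1]) (cst 1 t).
  rewrite Rintegral_cst//= lebesgue_measure_itv/= lte_fin ltr01/=.
  by rewrite subr0 !mulr1.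
apply: (le_Rintegral_scaled il i1) => t t01.
have Ut : U t by apply: U01; rewrite /= in_itv.
rewrite /cst mulr1.
have -> : speed G c t = tnorm G (c t) (w *m to_tangent a (c t)).
  have e := (dbc (chart_at (c t)) t 1 (chart_at_atlas _) Ut (chart_at_dom _)).2.
  by rewrite scale1r in e; congr (tnorm G (c t) _); exact: e.
by have [_ _] := rP _ Ut; apply.
Qed.

(** Up to a first exit time from the chart ball, the displacement estimate keeps
    the curve in a smaller closed ball. The latter is compact, hence closed in
    the manifold, so it still contains the curve at the exit time, which is
    absurd. *)
Lemma C1_curve_chart a p r k c : atlas a -> 0 < k ->
  (forall y, `|y - a p| < r -> [/\ dom a (chart_inv a y), a (chart_inv a y) = y &
    forall w, k * `|w| <=
      tnorm G (chart_inv a y) (w *m to_tangent a (chart_inv a y))]) ->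
  C1_curve c -> dom a (c 0) -> k * `|a (c 0) - a p| + curve_length G c < k * r ->
  forall t, 0 <= t <= 1 ->
  dom a (c t) /\ k * `|a (c t) - a (c 0)| <= curve_length G c.
Proof.
move=> aa k0 rP [U [oU U01 cc cC]] ac0 hlt.
have cU : curve_on U c by [].
pose O := [set q | dom a q /\ `|a q - a p| < r].
have OP q : O q -> dom a q /\ forall w, k * `|w| <= tnorm G q (w *m to_tangent a q).
  by move=> [aq qr]; split => //; have [_ _] := rP _ qr; rewrite chart_mapK.
have oO q : O q -> nbhs q O.
  move=> [aq qr]; have := near_dom aq.
  have : \forall y \near a q, `|y - a p| < r.
    by apply: open_nbhs_nbhs; split => //; exact: open_norm_lt.
  by move=> /(near_chart aq); apply: filterS2.
have L0 := curve_length_ge0 G c.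
set L := curve_length G c in hlt L0 *.
(* The radius that the displacement estimate gives before the first exit. *)
pose r' := `|a (c 0) - a p| + L / k.
have r'r : r' < r.
  rewrite /r' -(ltr_pM2l k0) mulrDr [k * (L / k)]mulrC divfK// gt_eqF//.
have inball q : dom a q -> k * `|a q - a (c 0)| <= L -> `|a q - a p| <= r'.
  move=> aq; rewrite -ler_pdivlMl// mulrC => h.
  rewrite -(subrK (a (c 0)) (a q)) -addrA addrC (le_trans (ler_normD _ _))//.
  by rewrite lerD.
pose K := chart_inv a @` [set y | `|y - a p| <= r'].
have cK : closed K.
  apply: (compact_closed (@carrier_hausdorff _ _ M)).
  apply: continuous_compact.
    apply: continuous_in_subspaceT => y; rewrite inE /= => yr.
    have [ay e _] := rP y (le_lt_trans yr r'r).
    by apply: chart_inv_continuous; exists (chart_inv a y).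
  apply: bounded_closed_compact.
    exists (`|a p| + r'); split; first exact: num_real.
    move=> x hx y /= hy; rewrite (le_trans _ (ltW hx))//.
    by rewrite -(subrK (a p) y) (le_trans (ler_normD _ _))// addrC lerD.
  exact: closed_norm_le.
have KO q : K q -> O q.
  move=> [y /= yr <-]; have [ay e _] := rP y (le_lt_trans yr r'r).
  by split => //; rewrite e (le_lt_trans yr).
have r'0 : `|a (c 0) - a p| < r.
  by apply: le_lt_trans r'r; rewrite /r' lerDl divr_ge0// ltW.
have Oc0 : O (c 0) by [].
have disp s : 0 <= s <= 1 -> (forall t, 0 <= t <= s -> O (c t)) ->
    k * `|a (c s) - a (c 0)| <= L.
  move=> s01 hO; apply: (chart_displacement cU U01 aa k0 s01) => t ts.
  by apply: OP; exact: hO.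
have dispK s : 0 <= s <= 1 -> (forall t, 0 <= t <= s -> O (c t)) -> K (c s).
  move=> s01 hO; have [acs _] : O (c s) by apply: hO; case/andP: s01 => -> _ /=.
  by exists (a (c s)); [exact: inball (disp s s01 hO)|rewrite chart_mapK].
pose E := [set t : R | 0 <= t <= 1 /\ ~ O (c t)].
have [E0|E0] := pselect (E !=set0); last first.
  have hO t : 0 <= t <= 1 -> O (c t).
    by move=> t01; apply: contrapT => nO; apply: E0; exists t.
  move=> t t01; split; first exact: (hO t t01).1.
  apply: disp => // s /andP[s0 st]; apply: hO; rewrite s0 /=.
  by case/andP: t01 => _; exact: le_trans.
exfalso.
have iE : has_inf E by split => //; exists 0 => t [/andP[]].
pose t0 := inf E.
have t00 : 0 <= t0 by apply: lb_le_inf => // t [/andP[]].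
have t01 : t0 <= 1.
  by have [t Et] := E0; apply: le_trans (ge_inf iE.2 Et) _; case: Et => /andP[].
have before t : 0 <= t -> t < t0 -> O (c t).
  move=> t_ge0 tt0; apply: contrapT => nO.
  suff : t0 <= t by rewrite leNgt tt0.
  apply: ge_inf; first exact: iE.2.
  by split => //; rewrite t_ge0 /= (le_trans (ltW tt0)).
have Ut0 : U t0 by apply: U01; rewrite /= in_itv /= t00.
have Kt0 : O (c t0).
  have [->//|tn0] := eqVneq t0 0.
  have tp : 0 < t0 by rewrite lt_neqAle eq_sym tn0.
  apply: KO; apply: contrapT => nK.
  have nKc : nbhs (c t0) (~` K) by apply: open_nbhs_nbhs; split => //; exact: closed_openC.
  have /nbhs_ballP[e /= e0 eP] : nbhs t0 (c @^-1` (~` K)) by exact: cc.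
  pose s := Num.max (t0 / 2) (t0 - e / 2).
  have s_lt : s < t0 by rewrite /s gt_max; apply/andP; split; lra.
  have s_ge : t0 - e / 2 <= s by rewrite /s le_max lexx orbT.
  have s0 : 0 <= s by rewrite /s le_max divr_ge0// ltW.
  apply: (eP s).
    by rewrite -ball_normE /= ger0_norm ?subr_ge0 ?ltW//; lra.
  apply: dispK; first by rewrite s0 /= (le_trans (ltW s_lt)).
  by move=> t /andP[t_ge0 ts]; apply: before => //; exact: le_lt_trans s_lt.
have /nbhs_ballP[e /= e0 eP] : nbhs t0 (c @^-1` O) by apply: cc => //; exact: oO.
have [t Et tlt] := inf_adherent e0 iE.
apply: Et.2; apply: eP; rewrite -ball_normE /= distrC ger0_norm.
  by rewrite -/t0 in tlt; lra.
by rewrite subr_ge0; apply: ge_inf => //; exact: iE.2.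
Qed.

End Distance.

Section LocalDistance.
Context {R : realType} {d : nat} {M : manifold R d}.
Variable G : riemannian_metric M.
Implicit Types (a : chart R d M) (p q u : M).

Lemma joined_chart a p r k : atlas a -> 0 < k ->
  (forall y, `|y - a p| < r -> [/\ dom a (chart_inv a y), a (chart_inv a y) = y &
    forall w, k * `|w| <=
      tnorm G (chart_inv a y) (w *m to_tangent a (chart_inv a y))]) ->
  forall u q l, joined G u q l -> dom a u -> k * `|a u - a p| + l < k * r ->
  dom a q /\ k * `|a q - a u| <= l.
Proof.
move=> aa k0 rP u q l; elim=> [{}u au _|c {}q {}l cC ql IH ac0 hl].
  by split => //; rewrite subrr normr0 mulr0.
have l0 := joined_ge0 ql.
have h0 : k * `|a (c 0) - a p| + curve_length G c < k * r.
  by apply: le_lt_trans hl; rewrite addrA lerDl.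
have [|ac1 h1] := C1_curve_chart aa k0 rP cC ac0 h0 (t := 1).
  by rewrite ler01 lexx.
have tri : k * `|a (c 1) - a p| <= k * `|a (c 0) - a p| + curve_length G c.
  rewrite -(subrK (a (c 0)) (a (c 1))) -addrA.
  apply: (@le_trans _ _ (k * (`|a (c 1) - a (c 0)| + `|a (c 0) - a p|))).
    by rewrite ler_wpM2l ?ler_normD// ltW.
  by rewrite mulrDr addrC lerD2l.
have [|aq h2] := IH ac1.
  by apply: le_lt_trans hl; rewrite addrA lerD2r.
split => //; rewrite -(subrK (a (c 1)) (a q)) -addrA.
apply: (@le_trans _ _ (k * (`|a q - a (c 1)| + `|a (c 1) - a (c 0)|))).
  by rewrite ler_wpM2l ?ler_normD// ltW.
by rewrite mulrDr addrC lerD.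
Qed.

(** Each piece of the curve remains in the chart ball, so that a bound of the
    derivative on the whole ball applies to all pieces. *)
Lemma joined_chart_map a p r k (h : M -> M) K : atlas a -> 0 < k ->
  (forall y, `|y - a p| < r -> [/\ dom a (chart_inv a y), a (chart_inv a y) = y &
    forall w, k * `|w| <=
      tnorm G (chart_inv a y) (w *m to_tangent a (chart_inv a y))]) ->
  C1_map h ->
  (forall q, dom a q -> `|a q - a p| < r -> diff_norm G h q <= K) ->
  forall u q l, joined G u q l -> dom a u -> k * `|a u - a p| + l < k * r ->
  exists2 l', joined G (h u) (h q) l' & l' <= K * l.
Proof.
move=> aa k0 rP hC hK u q l; elim=> [{}u au _|c {}q {}l cC ql IH ac0 hl].
  by exists 0; [exact: joined_refl|rewrite mulr0].
have l0 := joined_ge0 ql.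
have h0 : k * `|a (c 0) - a p| + curve_length G c < k * r.
  by apply: le_lt_trans hl; rewrite addrA lerDl.
have inC := C1_curve_chart aa k0 rP cC ac0 h0.
have tri t : 0 <= t <= 1 ->
    k * `|a (c t) - a p| <= k * `|a (c 0) - a p| + curve_length G c.
  move=> t01; rewrite -(subrK (a (c 0)) (a (c t))) -addrA.
  apply: (@le_trans _ _ (k * (`|a (c t) - a (c 0)| + `|a (c 0) - a p|))).
    by rewrite ler_wpM2l ?ler_normD// ltW.
  by rewrite mulrDr addrC lerD2l (inC t t01).2.
have t11 : (0 : R) <= (1 : R) <= 1 by rewrite ler01 lexx.
have [|l' ql' hl'] := IH (inC 1 t11).1.
  by apply: le_lt_trans hl; rewrite addrA lerD2r tri.
have [U [oU U01 cc cA]] := cC.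
have cU : curve_on U c by [].
exists (curve_length G (h \o c) + l').
  have hcC : C1_curve (h \o c).
    by have [? ? ?] := curve_on_comp cU hC; exists U; split.
  exact: (joined_cons hcC ql').
rewrite mulrDr lerD//; apply: (curve_length_comp cU U01 hC) => t t01.
apply: hK; first exact: (inC t t01).1.
by rewrite -(ltr_pM2l k0) (le_lt_trans (tri t t01)).
Qed.

(** All that is used of [dist] near [p]: it is comparable with the norm of the
    chart. This is stated for lengths of joining curves, since it also serves
    to show that joining curves exist. In the lower bound the second point is
    not assumed to lie in the chart: this is part of the conclusion. *)
Definition comparison_ball (P : set M) a p (r k C : R) : Prop :=
  [/\ 0 < r, 0 < k & 0 < C] /\
  [/\ (forall y, `|y - a p| < r -> [/\ dom a (chart_inv a y),
      a (chart_inv a y) = y, P (chart_inv a y) &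
      forall w, k * `|w| <=
        tnorm G (chart_inv a y) (w *m to_tangent a (chart_inv a y))]),
    (forall u q l, joined G u q l -> dom a u ->
      k * `|a u - a p| + l < k * r -> dom a q /\ k * `|a q - a u| <= l) &
    (forall u q, dom a u -> dom a q -> `|a u - a p| < r -> `|a q - a p| < r ->
      exists2 l, joined G u q l & l <= C * `|a q - a u|)].

Lemma comparison_ball_exists (P : set M) a p : atlas a -> dom a p -> nbhs p P ->
  exists r k C, comparison_ball P a p r k C.
Proof.
move=> aa ap pP; have [k [C [k0 C0 nP]]] := tnorm_chart_near G aa ap.
have [r r0 rP] := chart_ball ap (filterI pP nP).
exists r, k, C; split; first by split.
split.
- by move=> y /rP[? ? [? h]]; split => // w; exact: (h w).1.
- by apply: joined_chart => // y /rP[? ? [? h]]; split => // w; exact: (h w).1.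
move=> u q au aq ur qr.
have rP' y : `|y - a p| < r -> [/\ dom a (chart_inv a y), a (chart_inv a y) = y &
    forall w, tnorm G (chart_inv a y) (w *m to_tangent a (chart_inv a y))
      <= C * `|w|].
  by move=> /rP[? ? [? h]]; split => // w; exact: (h w).2.
have [l] := joined_chart_segment aa C0 rP' ur qr.
by rewrite !chart_mapK// => ? ?; exists l.
Qed.

Lemma near_norm_chart a p r : dom a p -> 0 < r ->
  \forall q \near p, dom a q /\ `|a q - a p| < r.
Proof.
move=> ap r0; have h1 := near_dom ap.
have : \forall y \near a p, `|y - a p| < r.
  apply: open_nbhs_nbhs; split; first exact: open_norm_lt.
  by rewrite /= subrr normr0.
by move=> /(near_chart ap); apply: filterS2 h1.
Qed.

Hypothesis hconnected : connected [set: M].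

(** The points joined to [p] form an open and closed set. This is where
    connectedness enters: without it the infimum defining [dist] could be taken
    over the empty set, and would then be 0. *)
Lemma joined_exists p q : exists l, joined G p q l.
Proof.
pose A := [set q | exists l, joined G p q l].
suff : A = [set: M] by move=> AT; have : A q by rewrite AT.
have near_joined u : \forall v \near u,
    (exists l, joined G u v l) /\ exists l, joined G v u l.
  have au := chart_at_dom u.
  have [r [k [C [[r0 k0 C0] [_ _ hC]]]]] :=
    comparison_ball_exists (chart_at_atlas u) au filterT.
  have u0 : `|chart_at u u - chart_at u u| < r by rewrite subrr normr0.
  apply: filterS (near_norm_chart au r0) => v [av vr].
  by split; [have [l ? _] := hC u v au av u0 vr|have [l ? _] := hC v u av au vr u0];
    exists l.
apply: hconnected.
- by exists p, 0; exact: joined_refl.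
- exists A; last by rewrite setTI.
  rewrite openE => u [l pu]; apply: filterS (near_joined u) => v [[l' uv] _].
  by exists (l + l'); exact: joined_trans uv.
exists A; last by rewrite setTI.
move=> u clu; have [v [[l pv] [_ [l' vu]]]] := clu _ (near_joined u).
by exists (l + l'); exact: joined_trans vu.
Qed.

Let lengths_inf p q : has_inf [set l | joined G p q l].
Proof.
split; first by have [l] := joined_exists p q; exists l.
by exists 0 => l /joined_ge0.
Qed.

Lemma dist_ge0 p q : 0 <= dist G p q.
Proof.
by apply: lb_le_inf => [|l /joined_ge0//]; exact: (lengths_inf p q).1.
Qed.

Lemma dist_le p q l : joined G p q l -> dist G p q <= l.
Proof. by move=> pq; apply: ge_inf => //; exact: (lengths_inf p q).2. Qed.

Lemma dist_lt_joined p q e : dist G p q < e ->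
  exists2 l, joined G p q l & l < e.
Proof.
move=> he; have e0 : 0 < e - dist G p q by rewrite subr_gt0.
have [l pl hl] := inf_adherent e0 (lengths_inf p q).
by exists l => //; move: hl; rewrite -/(dist G p q) addrC subrK.
Qed.

Lemma dist_le_all p q x :
  (forall l, joined G p q l -> x <= l) -> x <= dist G p q.
Proof.
by move=> h; apply: lb_le_inf; [exact: (lengths_inf p q).1|exact: h].
Qed.

Lemma distxx p : dist G p p = 0.
Proof.
by apply/eqP; rewrite eq_le dist_ge0 andbT; apply: dist_le; exact: joined_refl.
Qed.

Lemma dist_triangle p q u : dist G p u <= dist G p q + dist G q u.
Proof.
apply/ler_addgt0Pr => e e0.
have e2 : 0 < e / 2 by rewrite divr_gt0.
have [|l pl hl] := @dist_lt_joined p q (dist G p q + e / 2); first by rewrite ltrDl.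
have [|l' ql hl'] := @dist_lt_joined q u (dist G q u + e / 2); first by rewrite ltrDl.
by apply: le_trans (dist_le (joined_trans pl ql)) _; lra.
Qed.

Lemma dist_chart_ge a p r k C u q (P : set M) :
  comparison_ball P a p r k C ->
  dom a u -> k * `|a u - a p| + dist G u q < k * r ->
  dom a q /\ k * `|a q - a u| <= dist G u q.
Proof.
move=> [[r0 k0 C0] [_ hk _]] au h.
have hd : dist G u q < k * r - k * `|a u - a p| by lra.
have [l0 uq0 hl0] := dist_lt_joined hd.
have [|aq _] := hk u q l0 uq0 au; first by lra.
split => //; apply: dist_le_all => l uq.
have [hl|hl] := ltP (k * `|a u - a p| + l) (k * r); first exact: (hk u q l uq au hl).2.
have [|_ h1] := hk u q l0 uq0 au; first by lra.
by apply: le_trans h1 _; lra.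
Qed.

Lemma dist_chart_le a p r k C u q (P : set M) :
  comparison_ball P a p r k C ->
  dom a u -> dom a q -> `|a u - a p| < r -> `|a q - a p| < r ->
  dist G u q <= C * `|a q - a u|.
Proof.
move=> [_ [_ _ hC]] au aq ur qr; have [l uq] := hC u q au aq ur qr.
exact: le_trans (dist_le uq).
Qed.

Lemma dist_ball_nbhs p (W : set M) : nbhs p W ->
  exists2 e, 0 < e & forall q, dist G p q < e -> W q.
Proof.
move=> pW; have ap := chart_at_dom p; pose a := chart_at p.
have [r [k [C cb]]] := comparison_ball_exists (chart_at_atlas p) ap pW.
have [[r0 k0 C0] [rP _ _]] := cb.
exists (k * r); first by rewrite mulr_gt0.
move=> q hq.
have [|aq h] := dist_chart_ge (u := p) (q := q) cb ap.
  by rewrite subrr normr0 mulr0 add0r.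
have : `|a q - a p| < r by rewrite -(ltr_pM2l k0) (le_lt_trans h).
by move=> /rP[_ _]; rewrite chart_mapK.
Qed.

Lemma dist_small_nbhs p e : 0 < e ->
  \forall q \near p, dist G p q < e.
Proof.
move=> e0; have ap := chart_at_dom p; pose a := chart_at p.
have [r [k [C cb]]] := comparison_ball_exists (chart_at_atlas p) ap filterT.
have [[r0 k0 C0] _] := cb.
have s0 : 0 < Num.min r (e / C) by rewrite lt_min r0 divr_gt0.
apply: filterS (near_norm_chart ap s0) => q [aq]; rewrite lt_min => /andP[qr qe].
have p0 : `|a p - a p| < r by rewrite subrr normr0.
rewrite (le_lt_trans (dist_chart_le cb ap aq p0 qr))// mulrC -ltr_pdivlMr//.
Qed.

Lemma dist_small_nbhs2 p e : 0 < e ->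
  exists2 W : set M, open_nbhs p W & forall u q, W u -> W q -> dist G u q < e.
Proof.
move=> e0; have ap := chart_at_dom p; pose a := chart_at p.
have [r [k [C cb]]] := comparison_ball_exists (chart_at_atlas p) ap filterT.
have [[r0 k0 C0] _] := cb.
have s0 : 0 < Num.min r (e / C / 2) by rewrite lt_min r0 !divr_gt0.
have := near_norm_chart ap s0; rewrite /prop_near1 nbhsE => -[W oW WP].
exists W => // u q /WP[au]; rewrite lt_min => /andP[ur ue] /WP[aq].
rewrite lt_min => /andP[qr qe].
rewrite (le_lt_trans (dist_chart_le cb au aq ur qr))// mulrC -ltr_pdivlMr//.
have -> : a q - a u = (a q - a p) - (a u - a p) by rewrite opprB addrA subrK.
by rewrite (le_lt_trans (ler_normB _ _))// (splitr (e / C)) ltrD.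
Qed.

Lemma dist_gt0 p q : p <> q -> 0 < dist G p q.
Proof.
move=> pq; rewrite lt_neqAle dist_ge0 andbT eq_sym; apply/eqP => d0.
apply: pq; apply: (@carrier_hausdorff _ _ M) => A B pA qB.
have [e e0 eP] := dist_ball_nbhs pA.
exists q; split; last exact: nbhs_singleton.
by apply: eP; rewrite d0.
Qed.

End LocalDistance.

(** * Uniform local stretching *)

Section Stretching.
Context {R : realType} {d : nat} {M : manifold R d}.
Variable G : riemannian_metric M.
Hypotheses (hcompact : compact [set: M]) (hconnected : connected [set: M]).
Variable h : M -> M.
Hypotheses (hC : C1_map h) (hunit : forall q, mdiff h q \in unitmx).
Implicit Types (z u w : M).

(** The derivative of [h] at [z] controls the stretching of the curve from [u]
    to [w] because all its points are joined to [z] by curves shorter than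
    [rho]. The radius is expressed by lengths of curves so that the estimate
    can be iterated on the images of the same curves. *)
Definition stretch_radius (e : R) z (rho : R) : Prop :=
  forall u w l l', joined G z u l -> joined G u w l' -> l + l' < rho ->
  exists2 l'', joined G (h u) (h w) l'' & l'' <= (1 + e) * diff_norm G h z * l'.

Lemma near_stretch_radius (e : R) (y : M) : 0 < e ->
  exists2 rho, 0 < rho & \forall z \near y, stretch_radius e z rho.
Proof.
move=> e0; pose a := chart_at y.
have aa : atlas a := chart_at_atlas _; have ay : dom a y := chart_at_dom _.
pose e' := Num.min 1 (e / 3).
have e'0 : 0 < e' by rewrite lt_min ltr01 divr_gt0.
have ee' : (1 + e') * (1 + e') <= 1 + e.
  have : e' <= 1 by rewrite ge_min lexx.
  have : e' <= e / 3 by rewrite ge_min lexx orbT.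
  by nra.
have nP := diff_norm_near G hC (hunit y) e'0.
have [r [k [C [[r0 k0 C0] [rP hk _]]]]] := comparison_ball_exists G aa ay nP.
have r2 : 0 < r / 2 by rewrite divr_gt0.
exists (k * (r / 2)); first by rewrite mulr_gt0.
apply: filterS (near_norm_chart ay r2) => z [az zr] u w l l' zu uw hl.
have l'0 := joined_ge0 uw.
have hz : k * `|a z - a y| < k * (r / 2) by rewrite ltr_pM2l.
have krr : k * r = k * (r / 2) + k * (r / 2) by rewrite -mulrDr -splitr.
have [|au hu] := hk z u l zu az; first by lra.
have hu' : k * `|a u - a y| + l' < k * r.
  apply: (@le_lt_trans _ _ (k * (`|a u - a z| + `|a z - a y|) + l')).
    rewrite lerD2r ler_wpM2l ?(ltW k0)//.
    by rewrite -{1}(subrK (a z) (a u)) -addrA ler_normD.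
  by rewrite mulrDr; lra.
have hK q : dom a q -> `|a q - a y| < r ->
    diff_norm G h q <= (1 + e) * diff_norm G h z.
  move=> aq /rP[_ _]; rewrite (chart_mapK aq) => -[h1 _] _.
  have zr' : `|a z - a y| < r.
    by apply: lt_trans zr _; rewrite ltr_pdivrMr// ltr_pMr// ltr1n.
  have [_ _] := rP _ zr'; rewrite (chart_mapK az) => -[_ h2] _.
  have z0 : 0 <= diff_norm G h z by exact: opnorm_ge0.
  have e1 : 0 <= 1 + e' by rewrite addr_ge0// ltW.
  apply: le_trans h1 _; apply: le_trans (ler_wpM2l e1 h2) _.
  by rewrite mulrA ler_wpM2r.
have rP' x : `|x - a y| < r -> [/\ dom a (chart_inv a x), a (chart_inv a x) = x &
    forall v, k * `|v| <=
      tnorm G (chart_inv a x) (v *m to_tangent a (chart_inv a x))].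
  by move=> /rP[].
exact: (joined_chart_map aa k0 rP' hC hK uw au hu').
Qed.

Lemma uniform_stretch_radius (e : R) : 0 < e ->
  exists2 rho, 0 < rho & forall z, stretch_radius e z rho.
Proof.
move=> e0.
have /compact_near_coveringP nc := hcompact.
have : \forall rho \near (0 : R)^'+, [set: M] `<=` [set z | stretch_radius e z rho].
  apply: nc => y _.
  have [rho0 rho00 nz] := near_stretch_radius y e0.
  exists ([set z | stretch_radius e z rho0], [set rho | rho < rho0]).
    by split => //=; exact: nbhs_right_lt.
  move=> [z rho] [/= hz hrho] u w l l' zu uw hl.
  exact: hz zu uw (lt_trans hl hrho).
move=> nr; near (0 : R)^'+ => rho.
exists rho; first by [].
by move=> z; apply: (near nr rho).
Unshelve. all: by end_near. Qed.

(** By induction on [i]: contraction up to time [i] keeps the images of the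
    curves within [rho] of the orbit of [z], where the derivative along the
    orbit, with the margin [(1 + e)], still controls the next step. *)
Lemma contraction_along_orbit (e rho lam : R) z n : 0 <= e -> 0 < lam <= 1 ->
  (forall q, stretch_radius e q rho) ->
  (forall i, (i <= n)%N ->
    (1 + e) ^+ i * \prod_(j < i) diff_norm G h (iter j h z) <= lam ^+ i) ->
  forall u w, dist G z u + dist G u w < rho ->
  forall i, (i <= n)%N ->
    dist G (iter i h u) (iter i h w) <= lam ^+ i * dist G u w.
Proof.
move=> e0 /andP[lam0 lam1] hrho hP u w huw.
pose P i := (1 + e) ^+ i * \prod_(j < i) diff_norm G h (iter j h z).
have P0 i : 0 <= P i.
  rewrite mulr_ge0 ?exprn_ge0 ?addr_ge0//.
  by apply: prodr_ge0 => j _; exact: opnorm_ge0.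
have PS i : P i.+1 = (1 + e) * diff_norm G h (iter i h z) * P i.
  by rewrite /P big_ord_recr exprS /=; ring.
have key l l' : joined G z u l -> joined G u w l' -> l + l' < rho ->
    forall i, (i <= n)%N -> exists l1 l2,
    [/\ joined G (iter i h z) (iter i h u) l1, joined G (iter i h u) (iter i h w) l2,
      l1 <= P i * l & l2 <= P i * l'].
  move=> zu uw hl; have l0 := joined_ge0 zu; have l'0 := joined_ge0 uw.
  elim=> [_|i IH hi].
    by exists l, l'; rewrite /P expr0 big_ord0 !mul1r; split.
  have [l1 [l2 [zu' uw' h1 h2]]] := IH (ltnW hi).
  have l10 := joined_ge0 zu'; have l20 := joined_ge0 uw'.
  have Pi1 : P i <= 1 by apply: le_trans (hP i (ltnW hi)) _; rewrite exprn_ile1// ltW.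
  have hl12 : l1 + l2 < rho.
    apply: le_lt_trans hl; apply: le_trans (lerD h1 h2) _.
    by rewrite -mulrDr ler_piMl// addr_ge0.
  have [|m1 zm1 hm1] := hrho _ _ _ 0 l1 (joined_refl _ _) zu'.
    by rewrite add0r (le_lt_trans _ hl12)// lerDl.
  have [m2 um2 hm2] := hrho _ _ _ l1 l2 zu' uw' hl12.
  exists m1, m2; rewrite !iterS PS -!(mulrA _ (P i)); split => //.
    apply: le_trans hm1 _; rewrite ler_wpM2l// mulr_ge0 ?addr_ge0//; exact: opnorm_ge0.
  apply: le_trans hm2 _; rewrite ler_wpM2l// mulr_ge0 ?addr_ge0//; exact: opnorm_ge0.
move=> i hi.
have huw1 : dist G z u < rho - dist G u w by lra.
have [l zu hl] := dist_lt_joined hconnected huw1.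
have huw2 : dist G u w < rho - l by lra.
have [l0 uw0 hl0] := dist_lt_joined hconnected huw2.
(* Curves from [u] to [w] too long for [key] are longer than the curve of
   length [l0], to which [key] applies. *)
have bound l' : joined G u w l' -> l + l' < rho ->
    dist G (iter i h u) (iter i h w) <= lam ^+ i * l'.
  move=> uw hl'; have [l1 [l2 [_ j2 _ h2]]] := key l l' zu uw hl' i hi.
  apply: le_trans (dist_le hconnected j2) _; apply: le_trans h2 _.
  by rewrite ler_wpM2r ?(joined_ge0 uw)// hP.
have lami : 0 < lam ^+ i by rewrite exprn_gt0.
rewrite -ler_pdivrMl//; apply: dist_le_all => // l' uw.
rewrite ler_pdivrMl//; have [hl'|hl'] := ltP (l + l') rho; first exact: bound.
apply: le_trans (bound l0 uw0 _) _; first by lra.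
by rewrite ler_wpM2l ?ltW//; lra.
Qed.

End Stretching.

(** * Hyperbolic times *)

Section HyperbolicTimes.
Context {R : realType}.

(** The first index at which [S] is below its minimum over [0, N] will do. This
    is a weak form of the lemma of Pliss: it gives infinitely many hyperbolic
    times, but not their frequency. *)
Lemma record_minima (S : nat -> R) :
  (forall B, exists n, S n < B) ->
  forall N, exists2 n, (N < n)%N & forall m, (m <= n)%N -> S n <= S m.
Proof.
move=> hS N.
have [B hB] : exists B, forall m, (m <= N)%N -> B <= S m.
  elim: N => [|N [B hB]].
    by exists (S 0%N) => m; rewrite leqn0 => /eqP->.
  exists (Num.min B (S N.+1)) => m; rewrite leq_eqVlt ge_min => /predU1P[->|].
    by rewrite lexx orbT.
  by rewrite ltnS => /hB->.
have exB : exists n, S n < B by exact: hS.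
have [n hn hmin] := ex_minnP exB.
exists n.
  by rewrite ltnNge; apply/negP => /hB; rewrite leNgt hn.
move=> m; rewrite leq_eqVlt => /predU1P[->//|mn].
have : B <= S m by rewrite leNgt; apply/negP => /hmin; rewrite leqNgt mn.
by apply: le_trans; exact: ltW.
Qed.

Lemma limn_einf_lt0 (u : nat -> R) : (limn_einf (EFin \o u) < 0)%E ->
  exists2 c, 0 < c & forall N, exists2 n, (N <= n)%N & u n < - c.
Proof.
move=> hu.
have [r hr r0] : exists2 r : R, (limn_einf (EFin \o u) < r%:E)%E & r < 0.
  move: hu; case E : (limn_einf _) => [s| |] // hs.
    have s0 : s < 0 by rewrite lte_fin in hs.
    by exists (s / 2); rewrite ?lte_fin; lra.
  by exists (-1); rewrite ?ltNyr// ltrN10.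
exists (- r); first by rewrite oppr_gt0.
move=> N; rewrite opprK.
have hN : (einfs (EFin \o u) N < r%:E)%E.
  apply: le_lt_trans hr; rewrite limn_einf_lim.
  rewrite (cvg_lim _ (@cvg_einfs_sup _ _))//.
  by apply: ereal_sup_ubound; exists N.
have [_ [n /= Nn <-] hn] := ereal_inf_lt hN.
by exists n.
Qed.

End HyperbolicTimes.

(** * Negative exponents give sources *)

Section Iterates.
Context {T : Type} (f finv : T -> T).
Hypotheses (fK : cancel f finv) (finvK : cancel finv f).

Lemma iter_cancel n : cancel (iter n f) (iter n finv).
Proof. by elim: n => [//|n IH] x; rewrite iterSr /= fK IH. Qed.

Lemma iter_backward n j x : (j <= n)%N ->
  iter j finv (iter n f x) = iter (n - j) f x.
Proof.
move=> jn; rewrite -{1}(subnKC jn) iterD.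
exact: iter_cancel.
Qed.

End Iterates.

Lemma finite_positive_min {R : realType} (N : nat) (Q : nat -> Prop)
    (delta : nat -> R) :
  (forall r, (r < N)%N -> Q r -> 0 < delta r) ->
  exists2 eta, 0 < eta & forall r, (r < N)%N -> Q r -> eta <= delta r.
Proof.
elim: N => [|N IH] hd; first by exists 1.
have [|eta eta0 heta] := IH; first by move=> r rN; apply: hd; exact: ltnW.
have [QN|nQN] := pselect (Q N); last first.
  exists eta => // r; rewrite ltnS leq_eqVlt => /predU1P[->//|]; exact: heta.
exists (Num.min eta (delta N)); first by rewrite lt_min eta0 hd.
move=> r; rewrite ltnS leq_eqVlt ge_min => /predU1P[-> _|rN Qr].
  by rewrite lexx orbT.
by rewrite heta.
Qed.

Lemma expr_small {R : realType} (lam e : R) : 0 <= lam < 1 -> 0 < e ->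
  exists N, forall n, (N <= n)%N -> lam ^+ n < e.
Proof.
move=> /andP[l0 l1] e0.
have c : lam ^+ n @[n --> \oo] --> (0 : R) by apply: cvg_expr; rewrite ger0_norm.
have [N _ hN] := cvgr_lt (0 : R) c e e0.
by exists N => n Nn; exact: hN.
Qed.

Section Sources.
Context {R : realType} {d : nat} {M : manifold R d}.
Variable G : riemannian_metric M.
Hypotheses (hd : (0 < d)%N).
Hypotheses (hcompact : compact [set: M]) (hconnected : connected [set: M]).
Variables (f finv : M -> M) (hf : C1_diffeo f finv).
Implicit Types (x y p q : M) (k : nat).

Lemma mdiff_iter_inv_unit k q : mdiff (iter k finv) q \in unitmx.
Proof.
have [fK finvK fC finvC] := hf.
apply: (mdiff_unit (finv := iter k f)); try exact: C1_map_iter.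
exact: iter_cancel.
Qed.

Lemma norm_inv_diffE k q :
  norm_inv_diff G (iter k f) q = diff_norm G (iter k finv) (iter k f q).
Proof.
have [fK finvK fC finvC] := hf.
have e := invmx_mdiff (C1_map_iter k fC) (C1_map_iter k finvC) (iter_cancel fK k) q.
rewrite /norm_inv_diff /diff_norm (iter_cancel fK k q).
exact: congr1 e.
Qed.

Lemma diff_norm_inv_gt0 k q : 0 < diff_norm G (iter k finv) q.
Proof. by apply: opnorm_gt0 => //; exact: mdiff_iter_inv_unit. Qed.

Section NegativeExponent.
Variables (k : nat) (x : M).
Let g := iter k f.
Let gi := iter k finv.
Let phi := diff_norm G gi.
Let a (j : nat) := ln (phi (iter j.+1 g x)).

Lemma A_minusE : A_minus G f k x =
  limn_einf (EFin \o (fun n : nat => n%:R^-1 * \sum_(j < n) a j)).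
Proof.
rewrite /A_minus; congr limn_einf; apply/funext => n /=.
congr (_%:E); congr (_ * _); apply: eq_bigr => j _.
by rewrite norm_inv_diffE mulnC iterM.
Qed.

Let S c n := \sum_(j < n) (a j + c).

Lemma A_minus_lt0_unbounded : (A_minus G f k x < 0)%E ->
  exists2 c, 0 < c & forall B : R, exists n, S c n < B.
Proof.
rewrite A_minusE => /limn_einf_lt0[c c0 hc].
exists (c / 2); first by rewrite divr_gt0.
move=> B; have c2 : 0 < c / 2 by rewrite divr_gt0.
have B0 : 0 <= `|B| / (c / 2) by rewrite divr_ge0// ltW.
have [n hn an] := hc (Num.bound (`|B| / (c / 2))).+1.
have n0 : (0 < n)%N by apply: leq_trans hn.
exists n.
have nR : (0 : R) < n%:R by rewrite ltr0n.
rewrite /S big_split /= sumr_const card_ord -mulr_natr.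
rewrite mulrC ltr_pdivrMr// in an.
have hB : `|B| < n%:R * (c / 2).
  rewrite -ltr_pdivrMr//; apply: lt_le_trans (archi_boundP B0) _.
  by rewrite ler_nat; exact: ltnW.
have hB' : - `|B| <= B by rewrite lerNl -normrN ler_norm.
by nra.
Qed.

Variable c : R.
Hypothesis c0 : 0 < c.
Let hyperbolic n := forall m, (m <= n)%N -> S c n <= S c m.

Lemma hyperbolic_prod n i : (i <= n)%N ->
  \prod_(j < i) phi (iter j gi (iter n g x)) =
  expR (S c n - S c (n - i) - i%:R * c).
Proof.
have [fK finvK fC finvC] := hf.
elim: i => [|i IH] hi.
  by rewrite big_ord0 subn0 subrr mul0r subr0 expR0.
rewrite big_ord_recr /= IH ?(ltnW hi)//.
rewrite (iter_backward (iter_cancel fK k))//; last exact: ltnW.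
have [m hm] : exists m, (n - i)%N = m.+1 by exists (n - i).-1; rewrite prednK// subn_gt0.
have -> : (n - i.+1)%N = m by rewrite subnS hm.
rewrite hm -[phi _]lnK; last by rewrite posrE; exact: diff_norm_inv_gt0.
rewrite -expRD -/(a m); congr expR.
rewrite /S big_ord_recr /= -[i.+1]addn1 natrD mulrDl mul1r; ring.
Qed.

(* [c] is the rate of contraction at hyperbolic times, [e] the distortion. *)
Let e := expR (c / 2) - 1.
Let lam := expR (- (c / 2)).

Let lam01 : 0 < lam < 1.
Proof. by rewrite expR_gt0 /= expR_lt1 oppr_lt0 divr_gt0. Qed.

Let e_gt0 : 0 < e.
Proof. by rewrite subr_gt0 expR_gt1 divr_gt0. Qed.

(** Minimality of the sums at [n] makes the backward products from
    [iter n g x] decay at the rate [c]; half of this rate pays for the margin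
    [(1 + e)]. *)
Lemma hyperbolic_contraction n i : hyperbolic n -> (i <= n)%N ->
  (1 + e) ^+ i * \prod_(j < i) diff_norm G gi (iter j gi (iter n g x)) <= lam ^+ i.
Proof.
move=> hn hi; rewrite (hyperbolic_prod hi) /e addrC subrK /lam.
rewrite -!expRM_natl -expRD ler_expR.
have := hn (n - i)%N (leq_subr _ _).
by lra.
Qed.

Lemma hyperbolic_cluster : (forall B : R, exists n, S c n < B) ->
  exists y, forall W, nbhs y W -> forall N, exists n,
    [/\ (N < n)%N, hyperbolic n & W (iter n g x)].
Proof.
move=> hS; have hN N : exists n, (N < n)%N /\ hyperbolic n.
  by have [n ? ?] := record_minima hS N; exists n.
have [t ht] := choice hN.
pose u n := iter (t n) g x.
have FF : ProperFilter (u @ \oo) by exact: fmap_proper_filter.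
have [y [_ cy]] := hcompact FF filterT.
exists y => W yW N.
have uN : (u @ \oo) (u @` [set n | (N <= n)%N]).
  by exists N => // n /= Nn; exists n.
have [_ [[n /= Nn <-] Wn]] := cy _ _ uN yW.
exists (t n); have [tn hy] := ht n; split => //.
exact: leq_ltn_trans tn.
Qed.

(** Let [n < m] be hyperbolic times at which the orbit is very close to the
    same cluster point. The backward iterate by [m - n] contracts a
    neighbourhood [W] of the cluster point and moves the orbit at time [m] to
    the orbit at time [n], deep inside [W], so that [W] is mapped into
    itself. *)
Lemma contracted_ball : (forall B : R, exists n, S c n < B) ->
  exists (W : set M) (N : nat) (L : R),
  [/\ open W, (0 < N)%N, 0 <= L < 1 &
    [/\ forall u, W u -> W (iter N gi u),
      forall u w, W u -> W w ->
        dist G (iter N gi u) (iter N gi w) <= L * dist G u w,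
      exists B, forall u w, W u -> W w -> dist G u w <= B &
      forall J, exists n, (J < n)%N /\ W (iter n g x)]].
Proof.
move=> hS; have [y hy] := hyperbolic_cluster hS.
have [fK finvK fC finvC] := hf.
have [l0 l1] := andP lam01.
have [rho rho0 hrho] := uniform_stretch_radius G hcompact
  (C1_map_iter k finvC) (mdiff_iter_inv_unit k) e_gt0.
have rho2 : 0 < rho / 2 by rewrite divr_gt0.
have [W [oW Wy] hW] := dist_small_nbhs2 G hconnected y rho2.
have yW : nbhs y W by exact: open_nbhs_nbhs.
have [del del0 hdel] := dist_ball_nbhs G hconnected yW.
have del2 : 0 < del / 2 by rewrite divr_gt0.
pose W' := W `&` [set q | dist G y q < del / 2].
have yW' : nbhs y W' by apply: filterI => //; exact: dist_small_nbhs.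
have [N0 hN0] : exists N, forall n, (N <= n)%N -> lam ^+ n < del / rho.
  by apply: expr_small; rewrite ?divr_gt0// ltW.
have [n [_ _ [Wn dn]]] := hy W' yW' 0%N.
have [m [nm hm [Wm dm]]] := hy W' yW' (n + N0)%N.
pose N := (m - n)%N.
have Nm : (N <= m)%N by exact: leq_subr.
have N00 : (N0 <= N)%N.
  by rewrite /N leq_subRL ?(ltnW nm)// (leq_trans (leq_addr N0 n))// ltnW.
have N0' : (0 < N)%N by rewrite subn_gt0 (leq_ltn_trans (leq_addr N0 n)).
have contr u w : W u -> W w ->
    dist G (iter N gi u) (iter N gi w) <= lam ^+ N * dist G u w.
  move=> Wu Ww.
  have huw : dist G (iter m g x) u + dist G u w < rho.
    by have := hW _ _ Wm Wu; have := hW _ _ Wu Ww; lra.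
  have lam1 : 0 < lam <= 1 by rewrite l0 ltW.
  exact: (contraction_along_orbit hconnected (ltW e_gt0) lam1 hrho
    (fun i => @hyperbolic_contraction m i hm) huw Nm).
exists W, N, (lam ^+ N); split => //.
  by rewrite exprn_ge0 ?(ltW l0)//= exprn_ilt1// ?(ltW l0)// -lt0n.
split=> //.
- move=> u Wu; apply: hdel.
  have gN : iter N gi (iter m g x) = iter n g x.
    rewrite (iter_backward (iter_cancel fK k))// /N subKn//.
    by apply: ltnW; apply: leq_ltn_trans nm; exact: leq_addr.
  apply: le_lt_trans (dist_triangle G hconnected y (iter n g x) _) _.
  have h1 := contr _ _ Wm Wu; rewrite gN in h1.
  have h2 := hW _ _ Wm Wu; have h3 := hN0 N N00.
  have h4 : lam ^+ N * dist G (iter m g x) u <= lam ^+ N * (rho / 2).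
    by rewrite ler_wpM2l ?exprn_ge0 ?ltW.
  have h5 : lam ^+ N * (rho / 2) < del / 2.
    by move: h3; rewrite ltr_pdivlMr// mulrA ltr_pM2r.
  have h6 : dist G y (iter n g x) < del / 2 by exact: dn.
  by lra.
- by exists (rho / 2) => u w Wu Ww; rewrite ltW// hW.
move=> J; have [j [Jj _ Wj]] := hy W yW J; by exists j.
Qed.

End NegativeExponent.
End Sources.

Section Characterisation.
Context {R : realType} {d : nat} {M : manifold R d}.
Variable G : riemannian_metric M.
Hypotheses (hd : (0 < d)%N).
Hypotheses (hcompact : compact [set: M]) (hconnected : connected [set: M]).
Variables (f finv : M -> M) (hf : C1_diffeo f finv).
Implicit Types (x p q u w : M) (k : nat).

(** Write a late time [m] at which the orbit visits the contracted ball as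
    [j * N + r] with [r < N]. Then [iter r g x] is the image by [iter j F] of a
    point of the ball, so it is moved by [F] by at most a multiple of
    [L ^+ j]. As [r] takes finitely many values and [j] is as large as wanted,
    some [iter r g x] is fixed by [F]: the point [x] itself, and not only the
    limit of its orbit, is periodic. *)
Lemma negative_exponent_source k x : (0 < k)%N -> (A_minus G f k x < 0)%E ->
  in_repelling_orbit G f finv x.
Proof.
move=> k0 hA; have [fK finvK fC finvC] := hf.
have [c c0 hS] := A_minus_lt0_unbounded hf hA.
have [W [N [L [oW N0 /andP[L0 L1] [FW FL [B hB] hW]]]]] :=
  contracted_ball hd hcompact hconnected hf c0 hS.
set g := iter k f in hW; set gi := iter k finv in FW FL.
pose F := iter N gi.
have iterW j u : W u -> W (iter j F u).
  by move=> Wu; elim: j => [//|j IH]; rewrite iterS; exact: FW.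
have iterL j u w : W u -> W w ->
    dist G (iter j F u) (iter j F w) <= L ^+ j * dist G u w.
  move=> Wu Ww; elim: j => [|j IH]; first by rewrite mul1r.
  rewrite !iterS exprS -mulrA.
  apply: le_trans (FL _ _ (iterW j u Wu) (iterW j w Ww)) _.
  by rewrite ler_wpM2l.
have gK : cancel g gi by exact: iter_cancel.
have back m : W (iter m g x) -> forall j r, m = (j * N + r)%N ->
    iter r g x = iter j F (iter m g x).
  move=> _ j r ->; rewrite /F -iterM iterD.
  by rewrite (iter_cancel gK).
have [r [rN Wr Fr]] : exists r, [/\ (r < N)%N, W (iter r g x) &
    F (iter r g x) = iter r g x].
  apply: contrapT => hno.
  have [eta eta0 heta] : exists2 eta, 0 < eta & forall r, (r < N)%N ->
      W (iter r g x) -> eta <= dist G (iter r g x) (F (iter r g x)).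
    apply: (finite_positive_min (Q := fun r => W (iter r g x))) => r rN Wr.
    by apply: dist_gt0 => // Fr; apply: hno; exists r; split.
  have B1 : 0 < `|B| + 1 by rewrite ltr_wpDl.
  have [J hJ] : exists J, forall j, (J <= j)%N -> L ^+ j < eta / (`|B| + 1).
    by apply: expr_small; rewrite ?L0// divr_gt0.
  have [m [Jm Wm]] := hW (J * N)%N.
  have mE := divn_eq m N; set j := (m %/ N)%N in mE; set r := (m %% N)%N in mE.
  have rN : (r < N)%N by rewrite ltn_mod.
  have Jj : (J <= j)%N by rewrite leq_divRL// ltnW.
  have e := back m Wm j r mE.
  have Wr : W (iter r g x) by rewrite e; exact: iterW.
  have := heta r rN Wr; rewrite leNgt => /negP; apply.
  have -> : F (iter r g x) = iter j F (F (iter m g x)).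
    by rewrite e -iterS iterSr.
  rewrite [X in dist G X]e.
  have WF : W (F (iter m g x)) by exact: FW.
  apply: le_lt_trans (iterL j _ _ Wm WF) _.
  have Lj : 0 <= L ^+ j by rewrite exprn_ge0.
  have hBj := hB _ _ Wm WF.
  have hB1 : dist G (iter m g x) (F (iter m g x)) <= `|B| + 1.
    by apply: le_trans hBj _; apply: le_trans (ler_norm B) _; rewrite lerDl.
  apply: le_lt_trans (ler_wpM2l Lj hB1) _.
  by rewrite -ltr_pdivlMr//; exact: hJ.
pose p := iter r g x.
have FE u : iter (N * k) finv u = F u by rewrite iterM.
have gE n u : iter (n * k) f u = iter n g u by rewrite iterM.
have fp : iter (N * k) f p = p.
  have /(_ p) := iter_cancel finvK (N * k).
  by rewrite FE {1}/p Fr.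
have tau0 : (0 < N * k)%N by rewrite muln_gt0 N0.
exists p, (N * k)%N; split; first by split.
  have [r0|r0] := posnP r.
    by exists 0%N => //=; rewrite /p r0.
  exists (N * k - r * k)%N.
    by rewrite /= -mulnBl ltn_pmul2r// ltn_subrL r0.
  apply: (can_inj (iter_cancel fK (r * k))).
  rewrite -iterD subnKC; last by rewrite leq_mul2r (ltnW rN) orbT.
  by rewrite fp gE.
split; first by split => //; rewrite FE.
exists W; split.
- by apply: open_nbhs_nbhs; split.
- by move=> q Wq; rewrite FE; exact: FW.
exists ((1 + L) / 2); split; first by lra.
move=> q s Wq Ws qs; rewrite !FE.
apply: le_lt_trans (FL q s Wq Ws) _.
by rewrite ltr_pM2r; [lra|exact: dist_gt0].
Qed.

(** * Sources have negative exponents *)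

Lemma derive_norm_le (V W : normedModType R) (psi : V -> W) (y v : V) (K : R) :
  derivable psi y v ->
  (\forall z \near y, `|psi z - psi y| <= K * `|z - y|) ->
  `|'D_v psi y| <= K * `|v|.
Proof.
move=> dpsi hK.
have c : `|h^-1 *: (psi (h *: v + y) - psi y)| @[h --> 0^'] --> `|'D_v psi y|.
  by apply: cvg_norm; exact: dpsi.
have hv : h *: v + y @[h --> (0 : R)] --> (0 : R) *: v + y.
  by apply: cvgD; [apply: cvgZr_tmp; exact: cvg_id|exact: cvg_cst].
rewrite scale0r add0r in hv.
apply: (ler_cvg_to c (cvg_cst (K * `|v|))).
have h1 : \forall h \near (0 : R)^', `|psi (h *: v + y) - psi y| <= K * `|h *: v + y - y|.
  exact: (nbhs_dnbhs (hv _ hK)).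
have h2 : \forall h \near (0 : R)^', h != 0 by exact: nbhs_dnbhs_neq.
apply: filterS2 h1 h2 => h + h0.
rewrite addrK !normrZ normfV mulrCA => hh.
by rewrite ler_pdivrMl ?normr_gt0.
Qed.

(** The iterates of [F] contract [dist] by [lam ^+ n], and [dist] is comparable
    with the chart norm near [p] by constants that do not depend on [n]. A
    large [n] will absorb these constants, so that this crude comparison is as
    good as the sharp one between [dist] and the metric at [p]. *)
Lemma attracting_diff_norm (F : M -> M) p (V : set M) (lam : R) : C1_map F ->
  F p = p -> nbhs p V -> (forall q, V q -> V (F q)) -> 0 < lam < 1 ->
  (forall q u, V q -> V u -> dist G (F q) (F u) <= lam * dist G q u) ->
  exists2 K, 0 <= K & forall n v,
    tnorm G p (v *m mdiff (iter n F) p) <= K * lam ^+ n * tnorm G p v.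
Proof.
move=> FC Fp pV FV /andP[lam0 lam1] FL; pose a := chart_at p.
have aa : atlas a := chart_at_atlas _; have ap : dom a p := chart_at_dom _.
have [r [k [C cb]]] := comparison_ball_exists G aa ap pV.
have [[r0 k0 C0] [rP _ _]] := cb.
have iterV n q : V q -> V (iter n F q).
  by move=> Vq; elim: n => [//|n IH]; rewrite iterS; exact: FV.
have iterp n : iter n F p = p by elim: n => [//|n IH]; rewrite iterS IH.
have iterL n q u : V q -> V u ->
    dist G (iter n F q) (iter n F u) <= lam ^+ n * dist G q u.
  move=> Vq Vu; elim: n => [|n IH]; first by rewrite mul1r.
  rewrite !iterS exprS -mulrA.
  apply: le_trans (FL _ _ (iterV n q Vq) (iterV n u Vu)) _.
  by rewrite ler_wpM2l// ltW.
have Vp : V p by exact: nbhs_singleton.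
have Jn n (w : 'rV[R]_d) : `|w *m jac a a (iter n F) p| <= (C / k * lam ^+ n) * `|w|.
  have FnC := C1_map_iter n FC.
  have aFp : dom a (iter n F p) by rewrite iterp.
  have D := C1_map_differentiable FnC aa aa ap aFp.
  rewrite -(deriveEjacobian w D); apply: derive_norm_le; first exact: diff_derivable.
  have s0 : 0 < Num.min r (k * r / (C * lam ^+ n)).
    by rewrite lt_min r0 !(divr_gt0, mulr_gt0, exprn_gt0).
  apply/nbhs_ballP; exists (Num.min r (k * r / (C * lam ^+ n))) => //= z.
  rewrite -ball_normE /= distrC lt_min => /andP[zr zs].
  have [az ez Vz _] := rP z zr.
  rewrite chart_mapK// iterp; set q := chart_inv a z in az ez Vz *.
  have p0 : `|a p - a p| < r by rewrite subrr normr0.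
  have qr : `|a q - a p| < r by rewrite ez.
  have h1 : dist G p (iter n F q) <= lam ^+ n * (C * `|z - a p|).
    rewrite -{1}(iterp n); apply: le_trans (iterL n p q Vp Vz) _.
    rewrite ler_wpM2l ?exprn_ge0 ?(ltW lam0)// -ez.
    exact: (dist_chart_le hconnected cb ap az p0 qr).
  have h2 : dist G p (iter n F q) < k * r.
    have CL : 0 < C * lam ^+ n by rewrite mulr_gt0// exprn_gt0.
    move: zs; rewrite ltr_pdivlMr//; apply: le_lt_trans; apply: le_trans h1 _.
    by rewrite le_eqVlt; apply/orP; left; apply/eqP; ring.
  have [|aq h3] := dist_chart_ge hconnected cb ap (u := p) (q := iter n F q).
    by rewrite subrr normr0 mulr0 add0r.
  rewrite -(ler_pM2l k0); apply: le_trans h3 _; apply: le_trans h1 _.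
  rewrite le_eqVlt; apply/orP; left; apply/eqP; field.
  by rewrite gt_eqF.
have [c [C' [c0 C'0 /nbhs_singleton near_p]]] := tnorm_chart_near G aa ap.
have T1 : to_tangent a p = 1%:M by exact: (jac_id ap).
have cP v : c * `|v| <= tnorm G p v /\ tnorm G p v <= C' * `|v|.
  by have := near_p v; rewrite T1 mulmx1.
exists (C' * (C / k) / c).
  by rewrite !(divr_ge0, mulr_ge0)// ltW.
move=> n v.
have mE : mdiff (iter n F) p = jac a a (iter n F) p.
  by rewrite mdiffE iterp.
rewrite mE; apply: le_trans (cP _).2 _.
apply: le_trans (ler_wpM2l (ltW C'0) (Jn n v)) _.
have lamn : 0 < lam ^+ n by rewrite exprn_gt0.
have Ck0 : 0 < C / k by rewrite divr_gt0.
have [cPv _] := cP v.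
move: (tnorm G p v) `|v| cPv => t u cPv.
have -> : C' * (C / k) / c * lam ^+ n * t =
    C' * (C / k * lam ^+ n) * (c^-1 * t) by ring.
have h0 : 0 <= C' * (C / k * lam ^+ n).
  by apply: mulr_ge0; [exact: ltW|apply: mulr_ge0; exact: ltW].
have h : u <= c^-1 * t by rewrite ler_pdivlMl.
rewrite (mulrA C' (C / k * lam ^+ n) u).
exact: ler_wpM2l h0 _ _ h.
Qed.

Lemma A_minus_fixed k x : iter k f x = x ->
  A_minus G f k x = (ln (diff_norm G (iter k finv) x))%:E.
Proof.
move=> fx; rewrite (A_minusE G hf).
have gx j : iter j (iter k f) x = x by elim: j => [//|j IH]; rewrite iterS IH.
apply: (cvg_limn_einf_sup _).1; apply: cvg_near_cst.
near=> n; rewrite /=; congr (_%:E).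
rewrite (eq_bigr (fun=> ln (diff_norm G (iter k finv) x))) => [|j _]; last first.
  by rewrite -(iterS j (iter k f)) gx.
rewrite sumr_const card_ord -[X in _ * X]mulr_natl mulrA mulVf ?mul1r//.
by rewrite pnatr_eq0 -lt0n; near: n; exists 1%N.
Unshelve. all: by end_near. Qed.

Lemma source_negative_exponent x : in_repelling_orbit G f finv x ->
  exists k, (0 < k)%N /\ (A_minus G f k x < 0)%E.
Proof.
move=> [p [tau [[tau0 fp] [i /= itau xE] [[_ finvp] [V [pV FV [lam [lam01 FL]]]]]]]].
have [fK finvK fC finvC] := hf.
pose F := iter tau finv.
have FL' q u : V q -> V u -> dist G (F q) (F u) <= lam * dist G q u.
  move=> Vq Vu; have [->|qu] := pselect (q = u); first by rewrite !distxx// mulr0.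
  by rewrite ltW// FL.
have [K K0 hK] := attracting_diff_norm (C1_map_iter tau finvC) finvp pV FV lam01 FL'.
have [lam0 lam1] := andP lam01.
have px : iter i finv x = p by rewrite -xE iter_cancel.
pose A := mdiff (iter i finv) x; pose B := mdiff (iter i f) p.
(* The summand 1 makes [Q] positive. *)
pose Q := opnorm G x p A * opnorm G p x B * K + 1.
have Q0 : 0 < Q by rewrite ltr_wpDl// !mulr_ge0// opnorm_ge0.
have [n0 hn0] : exists n0, forall n, (n0 <= n)%N -> lam ^+ n < Q^-1.
  by apply: expr_small; rewrite ?invr_gt0// ltW.
have [n [npos n0n]] : exists n, (0 < n)%N /\ (n0 <= n)%N by exists n0.+1.
have Fnp : iter n F p = p by elim: (n) => [//|m IH]; rewrite iterS IH.
pose k := (n * tau)%N.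
have k0 : (0 < k)%N by rewrite muln_gt0 npos.
have fkx : iter k f x = x.
  have fkp : iter k f p = p.
    by rewrite /k iterM; elim: (n) => [//|m IH]; rewrite iterS IH.
  by rewrite -xE -iterD addnC iterD fkp.
exists k; split => //.
rewrite A_minus_fixed// lte_fin.
have gE : iter k finv = iter i f \o (iter n F \o iter i finv).
  apply/funext => u /=.
  have -> : iter n F (iter i finv u) = iter k finv (iter i finv u).
    by rewrite /k iterM.
  have -> : iter k finv (iter i finv u) = iter i finv (iter k finv u).
    by rewrite -!iterD addnC.
  by rewrite (iter_cancel finvK i).
have gx : iter k finv x = x by rewrite -{1}fkx (iter_cancel fK k).
have FnC : C1_map (iter n F) := C1_map_iter n (C1_map_iter tau finvC).
have iC := C1_map_iter i finvC; have jC := C1_map_iter i fC.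
have mE : mdiff (iter k finv) x = A *m mdiff (iter n F) p *m B.
  have e1 := mdiff_comp x (C1_map_comp iC FnC) jC.
  have e2 := mdiff_comp x iC FnC.
  have q1 : (iter n F \o iter i finv) x = p by rewrite /= px.
  rewrite q1 in e1; rewrite px in e2; rewrite gE.
  exact: etrans e1 (congr1 (fun X => X *m B) e2).
have d1 : diff_norm G (iter k finv) x <= Q * lam ^+ n.
  have lamn : 0 <= lam ^+ n by rewrite exprn_ge0// ltW.
  apply: opnorm_le; first by rewrite mulr_ge0// ltW.
  move=> v; rewrite gx mE !mulmxA.
  apply: le_trans (tnorm_mul_le G p x B _) _.
  have OB : 0 <= opnorm G p x B by exact: opnorm_ge0.
  apply: le_trans (ler_wpM2l OB (hK n (v *m A))) _.
  have Kn : 0 <= K * lam ^+ n by rewrite mulr_ge0.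
  apply: le_trans (ler_wpM2l OB (ler_wpM2l Kn (tnorm_mul_le G x p A v))) _.
  have t0 := tnorm_ge0 G x v.
  have : 0 <= lam ^+ n * tnorm G x v by rewrite mulr_ge0.
  rewrite /Q; move: (opnorm G p x B) (opnorm G x p A) => b' a'; lra.
have := hn0 n n0n; rewrite -[Q^-1]mul1r ltr_pdivlMr// mulrC => hlt.
by apply: ln_lt0; rewrite (diff_norm_inv_gt0 G hd hf) (le_lt_trans d1).
Qed.

End Characterisation.

Theorem theorem2 (R : realType) (d : nat) (hd : (2 <= d)%N)
    (M : manifold R d) (hcompact : compact [set: M])
    (hconnected : connected [set: M])
    (G : riemannian_metric M)
    (f finv : M -> M) (hf : C1_diffeo f finv) (x : M) :
  in_repelling_orbit G f finv x <->
  exists k : nat, (0 < k)%N /\ (A_minus G f k x < 0)%E.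
Proof.
have d0 : (0 < d)%N by exact: ltnW.
split; first exact: source_negative_exponent.
move=> [k [k0 hk]]; exact: (negative_exponent_source d0 hcompact hconnected hf k0 hk).
Qed.
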